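(* The following estimates on $\mathbf{E}_{\mathrm{min}}^0$ hold. (1) For every $\mathsf{c}>0$, $$-\mathsf{c}<\mathbf{E}_{\mathrm{min}}^0<\min\left(-\frac{\mathsf{c}}{2},\ -\mathsf{c}+\tilde a_1\right).$$ (2) Let $\tau>0$ be arbitrarily small. For every $\mathsf{h}\in(0,(\tilde a_1+\tau)^{-3/2}]$, $$\mathbf{E}_{\mathrm{min}}^0=-\mathsf{h}^{-2/3}+\tilde a_1-\alpha\sqrt3\,\frac{(u'(-\tilde a_1))^2}{\tilde a_1}\,e^{-\frac43\mathsf{h}^{-1}+2\tilde a_1\mathsf{h}^{-1/3}}\left(1+\mathcal{O}(\mathsf{h}^{1/3})\right).$$
   Context: Let $\hbar,m,L_0,V_0>0$. Let $V$ be the $2L_0$-periodic function on $\mathbb{R}$ with $V(x)=V_0(|x|/L_0-1)$ for $x\in[-L_0,L_0]$, and $H=-\frac{\hbar^2}{2m}\frac{d^2}{dx^2}+V$ acting on the Sobolev space $H^2(\mathbb{R})$. Its spectrum is $\sigma(H)=\bigcup_{p\ge 0}[E_{\mathrm{min}}^p,E_{\mathrm{max}}^p]$, where $E_{\mathrm{min}}^0\le E_{\mathrm{max}}^1\le E_{\mathrm{min}}^2\le\dots$ are the eigenvalues of $-\frac{\hbar^2}{2m}\frac{d^2}{dx^2}+V$ on $[-L_0,L_0]$ with periodic boundary conditions, and $E_{\mathrm{max}}^0\le E_{\mathrm{min}}^1\le E_{\mathrm{max}}^2\le\dots$ those with antiperiodic boundary conditions. In particular $E_{\mathrm{min}}^0$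 is the bottom of the spectrum. Set $\theta=\left(\frac{2mL_0^2}{\hbar^2V_0^2}\right)^{1/3}$, $\mathsf{c}=\theta V_0$, $\mathsf{h}=\frac{\hbar}{L_0(2mV_0)^{1/2}}$, so $\mathsf{c}=\mathsf{h}^{-2/3}$, and $\mathbf{E}_{\mathrm{min}}^0=\theta E_{\mathrm{min}}^0$, which depends only on $\mathsf{c}$ (equivalently $\mathsf{h}$). Let $u$ be the solution of the Airy equation $y''=xy$ with $u(0)=1$, $u'(0)=0$. Let $-\tilde a_1$ be the largest zero of $Ai'$ (where $Ai$ is the Airy function) and $\alpha=-Ai(0)/Ai'(0)>0$. The $\mathcal{O}$ term is an estimate valid for all $\mathsf{h}$ in the indicated interval: it is bounded by $C\mathsf{h}^{1/3}$ with $C$ independent of $\mathsf{h}$ (possibly depending on $\tau$). *)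

(* Defs.v *)
(* Stdlib reals and Coquelicot. *)
From Stdlib Require Export Reals.
From Coquelicot Require Export Coquelicot.
Open Scope R_scope.

(* [Int_part ((x + L0) / (2 * L0))] counts the periods separating [x] from
   [[-L0, L0)], so that [V] is [2 * L0]-periodic and equals
   [V0 * (|x| / L0 - 1)] on [[-L0, L0]]. *)
Definition potential (L0 V0 x : R) : R :=
  V0 * (Rabs (x - 2 * L0 * IZR (Int_part ((x + L0) / (2 * L0)))) / L0 - 1).

(* Eigenvalues of [- hbar^2 / (2 m) d^2/dx^2 + V] on [[-L0, L0]] with periodic
   boundary conditions.  Since [V] is continuous, eigenfunctions in H^2 are
   C^2 up to the boundary, so the equation is taken in the classical sense.
   Total functions on R are used: only their values on [[-L0, L0]] matter, and
   asking for two-sided derivatives at the endpoints is harmless because a C^2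
   function on a closed interval extends to a C^2 function on R. *)
Definition periodic_eigenvalue (hbar m L0 V0 E : R) : Prop :=
  exists psi dpsi ddpsi : R -> C,
    (forall x, -L0 <= x <= L0 ->
       is_derive psi x (dpsi x) /\
       is_derive dpsi x (ddpsi x) /\
       (RtoC (- (hbar ^ 2 / (2 * m))) * ddpsi x
          + RtoC (potential L0 V0 x) * psi x = RtoC E * psi x)%C) /\
    psi (-L0) = psi L0 /\
    dpsi (-L0) = dpsi L0 /\
    (exists x, -L0 <= x <= L0 /\ psi x <> RtoC 0).

Definition is_Emin0 (hbar m L0 V0 E : R) : Prop :=
  periodic_eigenvalue hbar m L0 V0 E /\
  forall E', periodic_eigenvalue hbar m L0 V0 E' -> E <= E'.

Definition theta (hbar m L0 V0 : R) : R :=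
  Rpower (2 * m * L0 ^ 2 / (hbar ^ 2 * V0 ^ 2)) (1 / 3).

Definition cpar (hbar m L0 V0 : R) : R := theta hbar m L0 V0 * V0.

Definition hpar (hbar m L0 V0 : R) : R := hbar / (L0 * sqrt (2 * m * V0)).

Definition airy_solution (y : R -> R) (y0 y1 : R) : Prop :=
  (forall x, ex_derive y x) /\
  (forall x, is_derive (Derive y) x (x * y x)) /\
  y 0 = y0 /\ Derive y 0 = y1.

(* Euler's integral, convergent for [s > 0]. *)
Definition Gamma (s : R) : R :=
  RInt_gen (fun t => Rpower t (s - 1) * exp (- t))
           (at_right 0) (Rbar_locally p_infty).

(* The Airy function as in Abramowitz-Stegun 10.4.2-10.4.5: the solution of
   [y'' = x y] with Ai(0) = 3^(-2/3) / Gamma(2/3) and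
   Ai'(0) = - 3^(-1/3) / Gamma(1/3). *)
Definition is_Ai (Ai : R -> R) : Prop :=
  airy_solution Ai (Rpower 3 (- 2 / 3) / Gamma (2 / 3))
                   (- (Rpower 3 (- 1 / 3) / Gamma (1 / 3))).

Definition is_largest_zero (f : R -> R) (z : R) : Prop :=
  f z = 0 /\ forall x, f x = 0 -> x <= z.

(* Main.v *)
From Stdlib Require Import Lra Lia Psatz.
Require Import Defs.

(** Put [X = - c - theta * E].  Rescaling turns the eigenvalue equation on half a
    period into the Airy equation [y'' = x y] on [[X, X + c]].  The potential is
    even, so an eigenfunction has an even part, with Neumann conditions at both
    ends of that interval, and an odd part, with Dirichlet conditions there
    ([periodic_dichotomy]); conversely a Neumann solution extends to an
    eigenfunction ([neumann_periodic]).

    Let [A] be the multiple of Ai with [A 0 = 1].  The Wronskian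
    [A u' - A' u] is the constant [1 / alpha], called [airy_slope] below.  The
    Neumann condition reads [R X = R (X + c)] for the slope ratio [R = A' / u'],
    and everything rests on the identity [R' = x * airy_slope / u' ^ 2].
    First, [R] increases to its limit 0 along the positive half-line, so [A'] is negative and
    [A] positive to the right of [- a1]; this excludes [X >= 0] and the Dirichlet
    conditions for [X >= - a1].  The bounds in (1) then follow from the
    intermediate value theorem, since [neumann_gap] is negative at [X = 0] and
    positive at [X = - a1] and, when [c / 2 < a1], at [X = - c / 2]
    ([neumann_gap_symmetric]).  Second, integrating the identity down from
    infinity gives [R Z ~ - sqrt 3 * exp (- 4/3 * Z^(3/2))]
    ([slope_ratio_asymptotics]), while near [- a1] it gives
    [R X ~ - (X + a1) * a1 * airy_slope / u' (- a1) ^ 2].  Equating the two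
    yields (2), [X + a1] being the exponentially small splitting
    ([splitting_asymptotics]).

    Two facts about special functions enter: the solution that Gamma values
    single out as Ai is the one whose derivative stays bounded, and the constant
    in front of the exponential is exactly [sqrt 3].  Both come from the
    integrals [int_0^oo exp (- r^3/3) f (x r) dr] with [f''' = f], which solve the
    Airy equation ([airy_integral]).  With [f] bounded they give [A]
    ([pair_A'_bounded]); with [f = sum_k t^(3k) / (3k)!] they give [u], whose growth
    is then read off by Laplace's method ([pair_u'_asymptotics]).  The initial
    values involve the moments of [exp (- r^3/3)], which are the numbers
    [Gamma (1/3)] and [Gamma (2/3)] up to powers of 3, and their product is
    evaluated by a polar-coordinates argument in one variable ([moment_product]),
    which also gives the Gaussian integral. *)

(** * Calculus *)

Lemma mean_value (f f' : R -> R) (a b : R) :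
  a < b -> (forall x, a <= x <= b -> is_derive f x (f' x)) ->
  exists z, a < z < b /\ f b - f a = f' z * (b - a).
Proof.
  intros Hab Hf.
  destruct (MVT_cor2 f f' a b Hab) as [z [H1 H2]].
  - intros z Hz. apply is_derive_Reals. now apply Hf.
  - exists z. split; [lra | exact H1].
Qed.

Lemma derive_pos_lt (f f' : R -> R) (a b : R) :
  a < b -> (forall x, a <= x <= b -> is_derive f x (f' x)) ->
  (forall x, a < x < b -> 0 < f' x) -> f a < f b.
Proof.
  intros Hab Hf Hpos. destruct (mean_value f f' a b Hab Hf) as [z [Hz E]].
  specialize (Hpos z Hz). nra.
Qed.

Lemma derive_nonneg_le (f f' : R -> R) (a b : R) :
  a <= b -> (forall x, a <= x <= b -> is_derive f x (f' x)) ->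
  (forall x, a < x < b -> 0 <= f' x) -> f a <= f b.
Proof.
  intros Hab Hf Hpos. destruct (Req_dec a b) as [->|Hne]; [lra|].
  destruct (mean_value f f' a b ltac:(lra) Hf) as [z [Hz E]].
  specialize (Hpos z Hz). nra.
Qed.

Lemma derive_zero_eq (f : R -> R) (a b : R) :
  a <= b -> (forall x, a <= x <= b -> is_derive f x 0) -> f a = f b.
Proof.
  intros Hab Hf. destruct (Req_dec a b) as [->|Hne]; [easy|].
  destruct (mean_value f (fun _ => 0) a b ltac:(lra) Hf) as [z [Hz E]]. lra.
Qed.

Lemma is_derive_continuous (f : R -> R) (x l : R) :
  is_derive f x l -> continuous f x.
Proof. intros H. apply (ex_derive_continuous (V := R_NormedModule)). now exists l. Qed.

Lemma is_derive_eq (f : R -> R) (x l l' : R) :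
  is_derive f x l -> l = l' -> is_derive f x l'.
Proof. now intros H <-. Qed.

Lemma continuous_bounded (f : R -> R) (a b : R) :
  (forall x, a <= x <= b -> continuous f x) ->
  exists M, 0 < M /\ forall x, a <= x <= b -> Rabs (f x) <= M.
Proof.
  intros Hf. destruct (Rle_dec a b) as [Hab|Hab].
  - destruct (continuity_ab_maj (fun x => Rabs (f x)) a b Hab) as [z [Hz _]].
    + intros x Hx. apply continuity_pt_filterlim.
      apply continuous_comp with (f := f) (g := Rabs); [now apply Hf|].
      apply continuous_Rabs.
    + exists (Rabs (f z) + 1). split; [pose proof (Rabs_pos (f z)); lra|].
      intros x Hx. specialize (Hz x Hx). lra.
  - exists 1. split; [lra|]. intros x Hx; lra.
Qed.

Lemma ex_RInt_cont (f : R -> R) (a b : R) :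
  (forall t, Rmin a b <= t <= Rmax a b -> continuous f t) -> ex_RInt f a b.
Proof. intros Hf. now apply (ex_RInt_continuous (V := R_CompleteNormedModule)). Qed.

Lemma continuity_2d_pt_product (A B K : R -> R) (x t : R) :
  continuous A x -> continuous B t -> continuous K (x * t) ->
  continuity_2d_pt (fun u v => A u * (B v * K (u * v))) x t.
Proof.
  intros HA HB HK.
  repeat apply continuity_2d_pt_mult.
  - apply continuity_1d_2d_pt_comp with (g := fun u _ : R => u);
      [now apply continuity_pt_filterlim | apply continuity_2d_pt_id1].
  - apply continuity_1d_2d_pt_comp with (g := fun _ v : R => v);
      [now apply continuity_pt_filterlim | apply continuity_2d_pt_id2].
  - apply continuity_1d_2d_pt_comp with (g := fun u v : R => u * v);
      [now apply continuity_pt_filterlim |].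
    apply continuity_2d_pt_mult; [apply continuity_2d_pt_id1 | apply continuity_2d_pt_id2].
Qed.

(** The bound [lo] leaves room for integrands that have a pole outside the
    interval of integration. *)
Lemma is_derive_RInt_parameter (F F' : R -> R -> R) (lo a b x : R) :
  lo < Rmin a b ->
  (forall y t, lo < t -> is_derive (fun z => F z t) y (F' y t)) ->
  (forall y t, continuity_2d_pt F' y t) ->
  (forall y t, lo < t -> continuous (F y) t) ->
  is_derive (fun y => RInt (F y) a b) x (RInt (F' x) a b).
Proof.
  intros Hlo HF HF' Hc.
  replace (RInt (F' x) a b) with (RInt (fun t => Derive (fun z => F z t) x) a b).
  - apply is_derive_RInt_param.
    + apply filter_forall. intros y t Ht. exists (F' y t). apply HF. lra.
    + intros t Ht. apply continuity_2d_pt_ext_loc with (f := F').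
      * exists (mkposreal (t - lo) ltac:(lra)). simpl. intros u v _ Hv.
        symmetry. apply is_derive_unique, HF. apply Rabs_def2 in Hv. lra.
      * apply HF'.
    + apply filter_forall. intros y. apply ex_RInt_cont.
      intros t Ht. apply Hc. lra.
  - apply RInt_ext. intros t Ht. apply is_derive_unique, HF. lra.
Qed.

Lemma RInt_mult_const (k : R) (f : R -> R) (a b : R) :
  ex_RInt f a b -> RInt (fun t => k * f t) a b = k * RInt f a b.
Proof. intros H. apply (RInt_scal (V := R_CompleteNormedModule) f a b k H). Qed.

Lemma RInt_plus_R (f g : R -> R) (a b : R) :
  ex_RInt f a b -> ex_RInt g a b ->
  RInt (fun t => f t + g t) a b = RInt f a b + RInt g a b.
Proof. intros Hf Hg. apply (RInt_plus (V := R_CompleteNormedModule) f g a b Hf Hg). Qed.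

Lemma RInt_zero (a b : R) : RInt (fun _ => 0) a b = 0.
Proof. rewrite RInt_const. unfold scal; simpl; unfold mult; simpl. ring. Qed.

Lemma is_derive_RInt_upper (f : R -> R) (a x : R) :
  (forall t, continuous f t) -> is_derive (fun y => RInt f a y) x (f x).
Proof.
  intros Hf. apply (is_derive_RInt (V := R_NormedModule)) with (a := a).
  - apply filter_forall. intros y.
    apply (RInt_correct (V := R_CompleteNormedModule)).
    apply ex_RInt_cont. intros; apply Hf.
  - apply Hf.
Qed.

Lemma is_lim_p_infty_eps (f : R -> R) (l : R) :
  (forall eps, 0 < eps -> exists M, forall x, M < x -> Rabs (f x - l) < eps) ->
  is_lim f p_infty l.
Proof.
  intros H. apply is_lim_spec. intros eps.
  destruct (H eps (cond_pos eps)) as [M HM]. exists M. exact HM.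
Qed.

Lemma is_lim_nondecreasing (f : R -> R) (M : R) :
  (forall x y, 0 <= x -> x <= y -> f x <= f y) ->
  (forall x, 0 <= x -> f x <= M) ->
  exists l : R, is_lim f p_infty l /\ forall x, 0 <= x -> f x <= l.
Proof.
  intros Hmon Hb.
  destruct (completeness (fun y => exists x, 0 <= x /\ y = f x)) as [l [Hub Hl]].
  - exists M. intros y [x [Hx ->]]. now apply Hb.
  - exists (f 0), 0. split; [lra | easy].
  - assert (Hle : forall x, 0 <= x -> f x <= l).
    { intros x Hx. apply Hub. now exists x. }
    exists l. split; [|exact Hle].
    apply is_lim_p_infty_eps. intros eps Heps.
    destruct (Classical_Prop.classic (exists x, 0 <= x /\ l - eps < f x)) as [[x [Hx Hfx]]|Hn].
    + exists x. intros y Hy.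
      specialize (Hmon x y Hx ltac:(lra)). specialize (Hle y ltac:(lra)).
      apply Rabs_def1; lra.
    + exfalso. assert (l <= l - eps); [|lra].
      apply Hl. intros y [x [Hx ->]].
      destruct (Rle_dec (f x) (l - eps)) as [|Hgt]; [easy|].
      exfalso. apply Hn. exists x. split; lra.
Qed.

Lemma exp_le_compat (x y : R) : x <= y -> exp x <= exp y.
Proof. intros [H| ->]; [left; now apply exp_increasing | right; easy]. Qed.

(** Polynomial lower bounds for [exp] with explicit constants, obtained by
    cubing [1 + x <= exp x]. *)
Lemma exp_ge_cube (y : R) : 0 <= y -> (1 + y / 3) ^ 3 <= exp y.
Proof.
  intros Hy. replace y with (3 * (y / 3)) at 2 by field.
  replace (exp (3 * (y / 3))) with (exp (y / 3) ^ 3).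
  - apply pow_incr. split; [lra|]. apply exp_ineq1_le.
  - simpl. rewrite Rmult_1_r, <- !exp_plus. f_equal. field.
Qed.

(** * Truncated moments of [exp (- r ^ n / n)] *)

(** Dividing the exponent by [n] gives [w' = - r^(n-1) w]. *)
Definition weight (n : nat) (r : R) : R := exp (- (r ^ n / INR n)).

Definition moment (n i : nat) (x : R) : R :=
  RInt (fun r => r ^ i * weight n r) 0 x.

Lemma is_derive_weight n r : is_derive (weight (S n)) r (- r ^ n * weight (S n) r).
Proof.
  unfold weight. auto_derive; [easy|].
  change (Nat.pred (S n)) with n. 
  pose proof (not_0_INR (S n) ltac:(lia)) as H.
  unfold Rdiv.
  field_simplify; try easy.
Qed.

Lemma continuous_pow_weight n i r : continuous (fun r => r ^ i * weight n r) r.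
Proof.
  apply (ex_derive_continuous (V := R_NormedModule)). unfold weight. auto_derive. easy.
Qed.

Lemma is_derive_moment n i x : is_derive (moment n i) x (x ^ i * weight n x).
Proof.
  unfold moment. apply (is_derive_RInt_upper (fun r => r ^ i * weight n r)).
  intros; apply continuous_pow_weight.
Qed.

Lemma moment_0 n i : moment n i 0 = 0.
Proof. unfold moment. now rewrite RInt_point. Qed.

Lemma weight_pos n r : 0 < weight n r.
Proof. apply exp_pos. Qed.

Lemma moment_mono n i x y : 0 <= x -> x <= y -> moment n i x <= moment n i y.
Proof.
  intros Hx Hy.
  apply derive_nonneg_le with (f' := fun r => r ^ i * weight n r); [easy| |].
  - intros z _. apply is_derive_moment.
  - intros z Hz. apply Rmult_le_pos; [apply pow_le; lra | left; apply weight_pos].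
Qed.

Lemma moment_pos n i x : 0 < x -> 0 < moment n i x.
Proof.
  intros Hx. rewrite <- (moment_0 n i).
  apply derive_pos_lt with (f' := fun r => r ^ i * weight n r); [easy| |].
  - intros z _. apply is_derive_moment.
  - intros z Hz. apply Rmult_lt_0_compat; [apply pow_lt; lra | apply weight_pos].
Qed.

Lemma moment_scaling n i x :
  moment n i x = RInt (fun t => x ^ S i * t ^ i * weight n (x * t)) 0 1.
Proof.
  unfold moment.
  pose proof (RInt_comp_lin (V := R_CompleteNormedModule) (fun r => r ^ i * weight n r) x 0 0 1) as H.
  rewrite !Rplus_0_r, Rmult_0_r, Rmult_1_r in H. rewrite <- H.
  - apply RInt_ext. intros t _. rewrite !Rplus_0_r. unfold scal; simpl; unfold mult; simpl.
    rewrite Rpow_mult_distr. ring.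
  - apply ex_RInt_cont. intros; apply continuous_pow_weight.
Qed.

(** What remains of the weight [r^i s^j exp (- (r^n + s^n) / n)], [n = i + j + 2],
    on the quadrant once the radial variable is integrated out: the two terms
    stand for the sectors [s <= r] and [r <= s]. *)
Definition beta_density (i j : nat) (t : R) : R :=
  (t ^ i + t ^ j) / (1 + t ^ S (S (i + j))).

Lemma one_plus_pow_pos t n : - (1 / 2) < t -> 0 < 1 + t ^ S n.
Proof.
  intros Ht. destruct (Rle_dec 0 t) as [H0|H0].
  - pose proof (pow_le t (S n) H0). lra.
  - assert (Rabs (t ^ S n) < 1).
    { rewrite <- RPow_abs. rewrite Rabs_left by lra.
      apply pow_lt_1_compat; [lra | lia]. }
    apply Rabs_def2 in H. lra.
Qed.

(** Scaled to [[0, 1]], the derivative of the left-hand side becomes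
    [x^(n-1) * int_0^1 (t^i + t^j) w(x) w(x t) dt], and since
    [w(x) w(x t) = exp (- x^n (1 + t^n) / n)] this is also minus the derivative of
    the last integral.  For [n = 2] it is the classical elementary proof of the
    Gaussian integral. *)
Lemma moment_product i j x (n := S (S (i + j))) :
  0 <= x ->
  moment n i x * moment n j x =
  RInt (beta_density i j) 0 1
  - RInt (fun t => beta_density i j t * (weight n x * weight n (x * t))) 0 1.
Proof.
  intros Hx.
  set (Tail := fun y => RInt (fun t => beta_density i j t * (weight n y * weight n (y * t))) 0 1).
  assert (Hw : forall y, is_derive (weight n) y (- y ^ S (i + j) * weight n y))
    by (intros; apply is_derive_weight).
  assert (Hwc : forall y, continuous (weight n) y)
    by (intros y; eapply is_derive_continuous, Hw).
  assert (HT : forall y, is_derive Tail y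
     (RInt (fun t => (- y ^ S (i + j) * weight n y) * ((t ^ i + t ^ j) * weight n (y * t))) 0 1)).
  { intros y. apply (is_derive_RInt_parameter
      (fun y t => beta_density i j t * (weight n y * weight n (y * t)))
      (fun y t => (- y ^ S (i + j) * weight n y) * ((t ^ i + t ^ j) * weight n (y * t)))
      (- (1 / 2))).
    - rewrite Rmin_left; lra.
    - clear y. intros y t Ht.
      pose proof (one_plus_pow_pos t (S (i + j)) Ht) as Hp.
      assert (H1 : is_derive (fun z => weight n (z * t)) y (t * (- (y * t) ^ S (i + j) * weight n (y * t)))).
      { apply (is_derive_comp (weight n) (fun z => z * t)); [apply Hw | auto_derive; [easy|ring]]. }
      eapply is_derive_eq.
      { apply (is_derive_scal (fun z => weight n z * weight n (z * t))).
        apply (is_derive_mult (weight n) (fun z => weight n (z * t))); [apply Hw | apply H1|].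
        intros; apply Rmult_comm. }
      unfold beta_density, mult, plus; simpl AbelianGroup.sort; simpl.
      rewrite Rpow_mult_distr. 
      unfold n in Hp. simpl in Hp. field. lra.
    - clear y. intros y t. apply (continuity_2d_pt_product (fun y => - y ^ S (i + j) * weight n y)).
      + apply (ex_derive_continuous (V := R_NormedModule)). unfold weight. auto_derive. easy.
      + apply (ex_derive_continuous (V := R_NormedModule)). auto_derive. easy.
      + apply Hwc.
    - clear y. intros y t Ht. pose proof (one_plus_pow_pos t (S (i + j)) Ht) as Hp.
      apply (ex_derive_continuous (V := R_NormedModule)). unfold weight, beta_density.
      auto_derive. simpl in *. lra. }
  assert (HM : forall k y, is_derive (moment n k) y (y ^ k * weight n y))
    by (intros; apply is_derive_moment).
  assert (E : moment n i 0 * moment n j 0 + Tail 0 = moment n i x * moment n j x + Tail x).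
  { apply (derive_zero_eq (fun y => moment n i y * moment n j y + Tail y)); [easy|].
    intros y Hy. eapply is_derive_eq.
    { apply (is_derive_plus (fun y => moment n i y * moment n j y) Tail); [|apply HT].
      apply (is_derive_mult (moment n i) (moment n j)); [apply HM | apply HM|].
      intros; apply Rmult_comm. }
    unfold plus, mult; simpl AbelianGroup.sort; simpl.
    rewrite (moment_scaling n i y), (moment_scaling n j y).
    assert (EI : forall k, ex_RInt (fun t => y ^ S k * t ^ k * weight n (y * t)) 0 1).
    { intros k. apply ex_RInt_cont. intros t _.
      apply (ex_derive_continuous (V := R_NormedModule)). unfold weight. auto_derive. easy. }
    rewrite (Rmult_comm (RInt _ 0 1) (y ^ j * weight n y)).
    rewrite <- !RInt_mult_const, <- !RInt_plus_R.
    all: try (apply ex_RInt_cont; intros t _;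
      apply (ex_derive_continuous (V := R_NormedModule)); unfold weight; auto_derive; easy).
    transitivity (RInt (fun _ => 0) 0 1); [|apply RInt_zero]. apply RInt_ext. intros t _.
    simpl. rewrite pow_add. ring. }
  rewrite moment_0 in E.
  assert (HT0 : Tail 0 = RInt (beta_density i j) 0 1).
  { unfold Tail. apply RInt_ext. intros t _.
    assert (W0 : weight n 0 = 1).
    { unfold weight, n. rewrite pow_i by lia. unfold Rdiv.
      rewrite Rmult_0_l, Ropp_0. apply exp_0. }
    rewrite Rmult_0_l, W0. change (beta_density i j t * (1 * 1) = beta_density i j t). ring. }
  rewrite HT0 in E. fold (Tail x). lra.
Qed.

Lemma weight_le_1 n r : 0 <= r -> weight n r <= 1.
Proof.
  intros Hr. unfold weight. rewrite <- exp_0. apply exp_le_compat.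
  apply Ropp_le_cancel. rewrite Ropp_involutive, Ropp_0.
  destruct n as [|n].
  - simpl. unfold Rdiv. rewrite Rinv_0. lra.
  - apply Rdiv_le_0_compat; [now apply pow_le | apply lt_0_INR; lia].
Qed.

Lemma beta_density_bounds i j t : 0 <= t <= 1 -> 0 <= beta_density i j t <= 2.
Proof.
  intros Ht. unfold beta_density.
  pose proof (one_plus_pow_pos t (S (i + j)) ltac:(lra)) as Hp.
  pose proof (pow_le t (S (S (i + j))) ltac:(lra)).
  assert (B : forall k, 0 <= t ^ k <= 1).
  { intros k. split; [apply pow_le; lra|]. rewrite <- (pow1 k). apply pow_incr; lra. }
  pose proof (B i). pose proof (B j). split.
  - apply Rdiv_le_0_compat; lra.
  - apply Rle_div_l; lra.
Qed.

Lemma moment_product_error i j x (n := S (S (i + j))) :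
  0 <= x ->
  0 <= RInt (beta_density i j) 0 1 - moment n i x * moment n j x <= 2 * weight n x.
Proof.
  intros Hx. unfold n. rewrite moment_product by easy.
  match goal with |- 0 <= ?a - (?a - ?b) <= _ => replace (a - (a - b)) with b by (unfold Rminus; rewrite Ropp_plus_distr, Ropp_involutive, <- Rplus_assoc, Rplus_opp_r, Rplus_0_l; easy) end.
  fold n.
  assert (EI : ex_RInt (fun t => beta_density i j t * (weight n x * weight n (x * t))) 0 1).
  { apply ex_RInt_cont. intros t Ht. rewrite Rmin_left, Rmax_right in Ht by lra.
    pose proof (one_plus_pow_pos t (S (i + j)) ltac:(lra)) as Hp.
    apply (ex_derive_continuous (V := R_NormedModule)). unfold beta_density, weight.
    auto_derive. simpl in *. lra. }
  assert (B : forall t, 0 <= t <= 1 ->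
     0 <= beta_density i j t * (weight n x * weight n (x * t)) <= 2 * weight n x).
  { intros t Ht. pose proof (beta_density_bounds i j t Ht).
    pose proof (weight_pos n x). pose proof (weight_pos n (x * t)).
    pose proof (weight_le_1 n (x * t) ltac:(nra)).
    assert (0 < weight n x * weight n (x * t) <= weight n x) by nra. nra. }
  split.
  - apply RInt_ge_0; [lra | easy |]. intros t Ht. apply B. lra.
  - replace (2 * weight n x) with (RInt (fun _ => 2 * weight n x) 0 1).
    + apply RInt_le; [lra | easy | apply ex_RInt_const |]. intros t Ht. apply B. lra.
    + rewrite RInt_const. unfold scal; simpl; unfold mult; simpl. ring.
Qed.

Lemma moment_bounded i j (n := S (S (i + j))) :
  exists M, forall x, 0 <= x -> moment n i x <= M.
Proof.
  exists (RInt (beta_density i j) 0 1 / moment n j 1 + moment n i 1).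
  pose proof (moment_pos n j 1 ltac:(lra)) as Hj.
  pose proof (moment_pos n i 1 ltac:(lra)) as Hi.
  assert (Hb : forall x, 1 <= x -> moment n i x <= RInt (beta_density i j) 0 1 / moment n j 1).
  { intros x Hx. apply Rle_div_r; [easy|].
    pose proof (moment_product_error i j x ltac:(lra)) as [H _]. fold n in H.
    pose proof (moment_mono n j 1 x ltac:(lra) Hx).
    pose proof (moment_pos n i x ltac:(lra)). nra. }
  intros x Hx. destruct (Rle_dec 1 x) as [H1|H1].
  - specialize (Hb x H1). lra.
  - specialize (Hb 1 ltac:(lra)). pose proof (moment_mono n i x 1 Hx ltac:(lra)). lra.
Qed.

(** The full moment, [n ^ ((i + 1) / n - 1) * Gamma ((i + 1) / n)]. *)
Definition full_moment (n i : nat) : R := Lim (moment n i) p_infty.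

Lemma full_moment_spec i j (n := S (S (i + j))) :
  is_lim (moment n i) p_infty (full_moment n i) /\
  (forall x, 0 <= x -> moment n i x <= full_moment n i) /\ 0 < full_moment n i.
Proof.
  destruct (moment_bounded i j) as [M HM].
  destruct (is_lim_nondecreasing (moment n i) M) as [l [Hl Hle]].
  - intros; now apply moment_mono.
  - exact HM.
  - unfold full_moment. rewrite (is_lim_unique _ _ _ Hl). simpl.
    split; [exact Hl | split; [exact Hle |]].
    pose proof (moment_pos n i 1 ltac:(lra)). specialize (Hle 1 ltac:(lra)). lra.
Qed.

Lemma weight_lim n : is_lim (weight (S n)) p_infty 0.
Proof.
  apply is_lim_p_infty_eps. intros eps Heps.
  exists (Rmax 1 (INR (S n) / eps)). intros x Hx.
  pose proof (Rmax_l 1 (INR (S n) / eps)). pose proof (Rmax_r 1 (INR (S n) / eps)).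
  assert (Hn : 0 < INR (S n)) by (apply lt_0_INR; lia).
  rewrite Rminus_0_r, Rabs_pos_eq by (left; apply weight_pos).
  unfold weight. rewrite exp_Ropp.
  set (y := x ^ S n / INR (S n)).
  assert (Hy : / eps < y).
  { unfold y. apply Rlt_div_r; [easy|].
    assert (x * 1 <= x ^ S n).
    { simpl. apply Rmult_le_compat_l; [lra|]. apply pow_R1_Rle. lra. }
    unfold Rdiv in H0. nra. }
  assert (0 < / eps) by now apply Rinv_0_lt_compat.
  pose proof (exp_ineq1_le y).
  rewrite <- (Rinv_inv eps). apply Rinv_lt_contravar; [|lra].
  apply Rmult_lt_0_compat; [easy | apply exp_pos].
Qed.

(** Euler's reflection formula at the argument [(i + 1) / n]. *)
Lemma full_moment_product i j (n := S (S (i + j))) :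
  full_moment n i * full_moment n j = RInt (beta_density i j) 0 1.
Proof.
  destruct (full_moment_spec i j) as [Hi _].
  destruct (full_moment_spec j i) as [Hj _].
  replace (S (S (j + i))) with n in Hj by (unfold n; lia). fold n in Hi.
  assert (H1 : is_lim (fun x => moment n i x * moment n j x) p_infty
                 (full_moment n i * full_moment n j)).
  { apply (is_lim_mult _ _ _ _ _ Hi Hj). easy. }
  assert (H2 : is_lim (fun x => moment n i x * moment n j x) p_infty
                 (RInt (beta_density i j) 0 1)).
  { apply (is_lim_le_le_loc (fun x => RInt (beta_density i j) 0 1 - 2 * weight n x)
            (fun _ => RInt (beta_density i j) 0 1)).
    - exists 0. intros x Hx. pose proof (moment_product_error i j x ltac:(lra)) as H.
      fold n in H. lra.
    - replace (Finite (RInt (beta_density i j) 0 1)) with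
        (Rbar_minus (RInt (beta_density i j) 0 1) (Rbar_mult 2 0)) by (simpl; f_equal; ring).
      apply is_lim_minus'; [apply is_lim_const | ].
      simpl. rewrite Rmult_0_r. 
      replace (Finite 0) with (Rbar_mult 2 0) by (simpl; f_equal; ring).
      apply is_lim_scal_l. apply weight_lim.
    - apply is_lim_const. }
  apply is_lim_unique in H1. apply is_lim_unique in H2. congruence.
Qed.

Lemma RInt_of_antiderivative (f F : R -> R) (a b : R) :
  a <= b ->
  (forall x, a <= x <= b -> is_derive F x (f x)) ->
  (forall x, a <= x <= b -> continuous f x) ->
  RInt f a b = F b - F a.
Proof.
  intros Hab HF Hf. apply is_RInt_unique.
  apply (is_RInt_derive (V := R_CompleteNormedModule) F f).
  - intros x. rewrite Rmin_left, Rmax_right by easy. apply HF.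
  - intros x. rewrite Rmin_left, Rmax_right by easy. apply Hf.
Qed.

(** [Gamma (1 / 3) * Gamma (2 / 3) = 2 * PI / sqrt 3]: the integrand reduces to
    [1 / (1 - t + t ^ 2)]. *)
Lemma cubic_moments_product :
  full_moment 3 0 * full_moment 3 1 = 2 * PI / (3 * sqrt 3).
Proof.
  transitivity (RInt (beta_density 0 1) 0 1); [apply (full_moment_product 0 1)|].
  assert (H3 : 0 < sqrt 3) by (apply sqrt_lt_R0; lra).
  assert (H33 : sqrt 3 * sqrt 3 = 3) by (apply sqrt_sqrt; lra).
  rewrite (RInt_of_antiderivative (beta_density 0 1)
     (fun t => 2 / sqrt 3 * atan ((2 * t - 1) / sqrt 3))).
  - replace ((2 * 1 - 1) / sqrt 3) with (tan (PI / 6)) by (rewrite tan_PI6; field; lra).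
    replace ((2 * 0 - 1) / sqrt 3) with (- tan (PI / 6)) by (rewrite tan_PI6; field; lra).
    rewrite atan_opp, atan_tan by (pose proof PI_RGT_0; lra). field. lra.
  - lra.
  - intros x Hx. pose proof (one_plus_pow_pos x 2 ltac:(lra)) as Hp.
    unfold beta_density. auto_derive; [easy|]. simpl in *.
    assert (0 < 1 - x + x * x) by nra.
    assert (Hk : / sqrt 3 * / sqrt 3 = 1 / 3)
      by (rewrite <- Rinv_mult, H33; field).
    unfold Rdiv at 1. set (k := / sqrt 3) in *.
    transitivity (2 * 2 * (k * k) * / (1 + (2 * x + - (1)) * (2 * x + - (1)) * (k * k))).
    + replace ((2 * x + - (1)) * k * ((2 * x + - (1)) * k * 1))
        with ((2 * x + - (1)) * (2 * x + - (1)) * (k * k)) by ring. ring.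
    + rewrite Hk. field. split; nra.
  - intros x Hx. pose proof (one_plus_pow_pos x 2 ltac:(lra)) as Hp.
    apply (ex_derive_continuous (V := R_NormedModule)). unfold beta_density.
    auto_derive. simpl in *. lra.
Qed.

Lemma gaussian_moment : full_moment 2 0 = sqrt (PI / 2).
Proof.
  destruct (full_moment_spec 0 0) as [_ [_ Hpos]].
  rewrite <- (sqrt_square (full_moment 2 0)) by (left; apply Hpos).
  f_equal. transitivity (RInt (beta_density 0 0) 0 1); [apply (full_moment_product 0 0)|].
  rewrite (RInt_of_antiderivative (beta_density 0 0) (fun t => 2 * atan t)).
  - rewrite atan_1, atan_0. field.
  - lra.
  - intros x Hx. unfold beta_density. auto_derive; [easy|]. simpl. field. nra.
  - intros x Hx. pose proof (one_plus_pow_pos x 1 ltac:(lra)) as Hp.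
    apply (ex_derive_continuous (V := R_NormedModule)). unfold beta_density.
    auto_derive. simpl in *. lra.
Qed.

(** * The Gamma function at rational points *)

Lemma Rpower_pos x y : 0 < Rpower x y.
Proof. apply exp_pos. Qed.

Lemma Rpower_lt_reg (x y a : R) : 0 < x -> 0 < y -> 0 < a -> x < Rpower y a -> Rpower x (/ a) < y.
Proof.
  intros Hx Hy Ha H.
  replace y with (Rpower (Rpower y a) (/ a)).
  - apply Rlt_Rpower_l; [now apply Rinv_0_lt_compat | split; [easy | exact H]].
  - rewrite Rpower_mult, Rinv_r by lra. now apply Rpower_1.
Qed.

Lemma is_derive_root (N t : R) : 0 < N -> 0 < t ->
  is_derive (fun t => Rpower (N * t) (/ N)) t (Rpower (N * t) (/ N) / (N * t)).
Proof.
  intros HN Ht. unfold Rpower. auto_derive; [now apply Rmult_lt_0_compat|]. field. lra.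
Qed.

(** The substitution [t = r ^ n / n] turns Euler's integral into a moment. *)
Lemma Gamma_full_moment i j (n := S (S (i + j))) (s := INR (S i) / INR n) :
  Gamma s = Rpower (INR n) (1 - s) * full_moment n i.
Proof.
  destruct (full_moment_spec i j) as [Hlim [Hle Hpos]]. fold n in Hlim, Hle, Hpos.
  assert (Hn : 0 < INR n) by (apply lt_0_INR; unfold n; lia).
  clearbody n.
  set (C := Rpower (INR n) (1 - s)).
  set (root := fun t => Rpower (INR n * t) (/ INR n)).
  set (F := fun t => C * moment n i (root t)).
  assert (Hroot : forall t, 0 < t -> root t ^ n = INR n * t).
  { intros t Ht. unfold root. rewrite <- Rpower_pow by apply Rpower_pos.
    rewrite Rpower_mult, Rinv_l by lra. apply Rpower_1. nra. }
  assert (HF : forall t, 0 < t -> is_derive F t (Rpower t (s - 1) * exp (- t))).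
  { intros t Ht.
    assert (Dr : is_derive root t (root t / (INR n * t))).
    { now apply is_derive_root. }
    eapply is_derive_eq.
    { apply is_derive_scal. apply (is_derive_comp (moment n i) root); [apply is_derive_moment | exact Dr]. }
    unfold scal; simpl; unfold mult; simpl. unfold weight. rewrite Hroot by easy.
    replace (INR n * t / INR n) with t by (field; lra).
    replace (C * (root t / (INR n * t) * (root t ^ i * exp (- t))))
      with (C * (root t ^ S i / (INR n * t)) * exp (- t)) by (rewrite <- tech_pow_Rmult; field; lra).
    f_equal. rewrite <- Rpower_pow by apply Rpower_pos.
    unfold root. rewrite Rpower_mult.
    replace (/ INR n * INR (S i)) with s by (unfold s; field; lra).
    unfold C. rewrite <- Rpower_mult_distr by easy.
    unfold Rminus. rewrite !Rpower_plus, !Rpower_Ropp, !Rpower_1 by easy.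
    pose proof (Rpower_pos (INR n) s). field. lra. }
  unfold Gamma.
  replace (C * full_moment n i) with (C * full_moment n i - C * 0) by ring.
  apply is_RInt_gen_unique.
  apply is_RInt_gen_ext with (f := Derive F).
  { exists (fun x => 0 < x) (fun x => 0 < x).
    - exists (mkposreal 1 Rlt_0_1). easy.
    - now exists 0.
    - intros x y Hx Hy z Hz. simpl in Hz. apply is_derive_unique, HF.
      pose proof (Rmin_glb_lt x y 0 Hx Hy). lra. }
  apply is_RInt_gen_Derive.
  - exists (fun x => 0 < x) (fun x => 0 < x).
    + exists (mkposreal 1 Rlt_0_1). easy.
    + now exists 0.
    + intros x y Hx Hy z Hz. simpl in Hz. eexists. apply HF.
      pose proof (Rmin_glb_lt x y 0 Hx Hy). lra.
  - exists (fun x => 0 < x) (fun x => 0 < x).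
    + exists (mkposreal 1 Rlt_0_1). easy.
    + now exists 0.
    + intros x y Hx Hy z Hz. simpl in Hz.
      pose proof (Rmin_glb_lt x y 0 Hx Hy) as Hm.
      apply continuous_ext_loc with (g := fun t => Rpower t (s - 1) * exp (- t)).
      * exists (mkposreal z ltac:(lra)). intros t Ht. symmetry.
        apply is_derive_unique, HF. apply Rabs_def2 in Ht. simpl in Ht.
        unfold minus, plus, opp in Ht; simpl in Ht. lra.
      * apply (ex_derive_continuous (V := R_NormedModule)). unfold Rpower.
        auto_derive. lra.
  - (* root t -> 0, and the moments are continuous at 0 *)
    apply (filterlim_comp _ _ _ (fun t => moment n i (root t)) (fun y => C * y) _ (locally 0)).
    2:{ apply (continuous_scal_r (K := R_AbsRing) C (fun y => y) 0). apply continuous_id. }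
    apply (filterlim_comp _ _ _ root (moment n i) _ (locally 0)).
    2:{ rewrite <- (moment_0 n i) at 2. apply (is_derive_continuous (moment n i) 0 _ (is_derive_moment n i 0)). }
    intros P [eps HP].
    exists (mkposreal (Rpower eps (INR n) / INR n)
        ltac:(apply Rdiv_lt_0_compat; [apply Rpower_pos | easy])).
    intros t Ht Ht0. apply HP. 
    change (Rabs (t - 0) < Rpower eps (INR n) / INR n) in Ht.
    rewrite Rminus_0_r, Rabs_pos_eq in Ht by lra.
    change (Rabs (root t - 0) < eps).
    rewrite Rminus_0_r, Rabs_pos_eq by (left; apply Rpower_pos).
    apply Rpower_lt_reg; [nra | apply cond_pos | easy |].
    apply Rlt_div_r in Ht; [lra | easy].
  - apply (filterlim_comp _ _ _ (fun t => moment n i (root t)) (fun y => C * y) _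
      (locally (full_moment n i))).
    2:{ apply (continuous_scal_r (K := R_AbsRing) C (fun y => y) (full_moment n i)). apply continuous_id. }
    apply (filterlim_comp _ _ _ root (moment n i) _ (Rbar_locally p_infty)); [|exact Hlim].
    intros P [M HP]. exists (Rpower (Rmax 1 M) (INR n) / INR n).
    intros t Ht. apply HP.
    pose proof (Rmax_l 1 M). pose proof (Rmax_r 1 M).
    apply Rle_lt_trans with (Rmax 1 M); [easy|].
    apply Rlt_div_l in Ht; [|easy].
    pose proof (Rpower_pos (Rmax 1 M) (INR n)) as Hp.
    replace (Rmax 1 M) with (Rpower (Rpower (Rmax 1 M) (INR n)) (/ INR n)).
    + apply Rlt_Rpower_l; [now apply Rinv_0_lt_compat | lra].
    + rewrite Rpower_mult, Rinv_r by lra. apply Rpower_1. lra.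
Qed.

Lemma Gamma_one_third : Gamma (1 / 3) = Rpower 3 (2 / 3) * full_moment 3 0.
Proof.
  replace (1 / 3) with (INR 1 / INR 3) at 1 by (simpl; lra).
  replace (2 / 3) with (1 - INR 1 / INR 3) by (simpl; lra).
  replace (Rpower 3) with (Rpower (INR 3)) by (f_equal; simpl; lra).
  exact (Gamma_full_moment 0 1).
Qed.

Lemma Gamma_two_thirds : Gamma (2 / 3) = Rpower 3 (1 / 3) * full_moment 3 1.
Proof.
  replace (2 / 3) with (INR 2 / INR 3) at 1 by (simpl; lra).
  replace (1 / 3) with (1 - INR 2 / INR 3) by (simpl; lra).
  replace (Rpower 3) with (Rpower (INR 3)) by (f_equal; simpl; lra).
  exact (Gamma_full_moment 1 0).
Qed.

Lemma full_moment_pos : 0 < full_moment 3 0 /\ 0 < full_moment 3 1.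
Proof.
  split; [apply (full_moment_spec 0 1) | apply (full_moment_spec 1 0)].
Qed.

Lemma Ai_initial_values :
  Rpower 3 (- 2 / 3) / Gamma (2 / 3) = / (3 * full_moment 3 1) /\
  Rpower 3 (- 1 / 3) / Gamma (1 / 3) = / (3 * full_moment 3 0).
Proof.
  destruct full_moment_pos as [H0 H1].
  assert (E : Rpower 3 (1 / 3) * Rpower 3 (2 / 3) = 3).
  { rewrite <- Rpower_plus. replace (1 / 3 + 2 / 3) with 1 by field. apply Rpower_1. lra. }
  pose proof (Rpower_pos 3 (1 / 3)). pose proof (Rpower_pos 3 (2 / 3)).
  rewrite Gamma_one_third, Gamma_two_thirds. split.
  - replace (- 2 / 3) with (- (2 / 3)) by field. rewrite Rpower_Ropp.
    transitivity (/ (Rpower 3 (1 / 3) * Rpower 3 (2 / 3) * full_moment 3 1));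
      [field; repeat split; lra | now rewrite E].
  - replace (- 1 / 3) with (- (1 / 3)) by field. rewrite Rpower_Ropp.
    transitivity (/ (Rpower 3 (1 / 3) * Rpower 3 (2 / 3) * full_moment 3 0));
      [field; repeat split; lra | now rewrite E].
Qed.

(** * Solutions of the Airy equation *)

Definition airy (y y' : R -> R) : Prop :=
  forall x, is_derive y x (y' x) /\ is_derive y' x (x * y x).

Definition wronskian (y y' z z' : R -> R) (x : R) : R := y x * z' x - y' x * z x.

Lemma airy_continuous y y' x : airy y y' -> continuous y x /\ continuous y' x.
Proof.
  intros H. split; eapply is_derive_continuous; apply H.
Qed.

Lemma airy_scal k y y' : airy y y' -> airy (fun x => k * y x) (fun x => k * y' x).
Proof.
  intros H x. destruct (H x) as [H1 H2]. split.
  - now apply is_derive_scal.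
  - eapply is_derive_eq; [apply is_derive_scal, H2|]. ring.
Qed.

Lemma airy_combination a b y y' z z' : airy y y' -> airy z z' ->
  airy (fun x => a * y x + b * z x) (fun x => a * y' x + b * z' x).
Proof.
  intros Hy Hz x. destruct (Hy x), (Hz x). split.
  - apply (is_derive_plus (fun x => a * y x) (fun x => b * z x)); now apply is_derive_scal.
  - eapply is_derive_eq.
    + apply (is_derive_plus (fun x => a * y' x) (fun x => b * z' x)); apply is_derive_scal; eauto.
    + unfold plus; simpl. ring.
Qed.

Lemma wronskian_derive y y' z z' (dy dz : R) x :
  is_derive y x (y' x) -> is_derive y' x dy ->
  is_derive z x (z' x) -> is_derive z' x dz ->
  is_derive (wronskian y y' z z') x (y x * dz - dy * z x).
Proof.
  intros Hy Hy' Hz Hz'. unfold wronskian.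
  eapply is_derive_eq.
  { apply (is_derive_minus (fun x => y x * z' x) (fun x => y' x * z x));
      apply (is_derive_mult (K := R_AbsRing)); eauto; intros; apply Rmult_comm. }
  unfold minus, plus, opp, mult; simpl. ring.
Qed.

Lemma airy_wronskian y y' z z' x :
  airy y y' -> airy z z' -> wronskian y y' z z' x = wronskian y y' z z' 0.
Proof.
  intros Hy Hz.
  assert (H : forall t, is_derive (wronskian y y' z z') t 0).
  { intros t. destruct (Hy t), (Hz t).
    eapply is_derive_eq; [apply wronskian_derive; eauto|]. ring. }
  destruct (Rle_dec 0 x).
  - symmetry. now apply derive_zero_eq.
  - apply derive_zero_eq; [lra | auto].
Qed.

(** The number [1 / alpha]: minus the slope at the origin of the multiple of Ai
    with value 1 there, and hence also its Wronskian with [u]. *)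
Definition airy_slope : R := full_moment 3 1 / full_moment 3 0.

Lemma airy_slope_pos : 0 < airy_slope.
Proof. destruct full_moment_pos. now apply Rdiv_lt_0_compat. Qed.

(** The solution [u] of the statement and the multiple [A] of Ai, with their
    derivatives.  That [A] is the decaying solution is not part of the data; it is
    deduced from the value of [airy_slope]. *)
Record airy_pair (u u' A A' : R -> R) : Prop := {
  pair_u : airy u u';
  pair_A : airy A A';
  pair_u0 : u 0 = 1;
  pair_u'0 : u' 0 = 0;
  pair_A0 : A 0 = 1;
  pair_A'0 : A' 0 = - airy_slope }.

Lemma pair_wronskian u u' A A' x : airy_pair u u' A A' ->
  A x * u' x - A' x * u x = airy_slope.
Proof.
  intros [Hu HA U0 U1 A0 A1].
  pose proof (airy_wronskian A A' u u' x HA Hu) as E. unfold wronskian in E.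
  rewrite E, U0, U1, A0, A1. ring.
Qed.

(** Variation of constants: the Wronskians of [D] with [u] and [A] have
    derivatives [u e] and [A e], and together they determine [D']. *)
Lemma airy_perturbation u u' A A' X : airy_pair u u' A A' -> 0 < X ->
  exists K, forall (D D' e : R -> R) (eta : R),
    (forall x, is_derive D x (D' x)) ->
    (forall x, is_derive D' x (x * D x + e x)) ->
    (forall x, 0 <= x <= X -> Rabs (e x) <= eta) ->
    Rabs (D 0) <= eta -> Rabs (D' 0) <= eta ->
    Rabs (D' X) <= K * eta.
Proof.
  intros HP HX.
  assert (B : forall z z', airy z z' -> exists k, forall (D D' e : R -> R) (eta : R),
    (forall x, is_derive D x (D' x)) ->
    (forall x, is_derive D' x (x * D x + e x)) ->
    (forall x, 0 <= x <= X -> Rabs (e x) <= eta) ->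
    Rabs (D 0) <= eta -> Rabs (D' 0) <= eta ->
    Rabs (wronskian z z' D D' X) <= k * eta).
  { intros z z' Hz.
    destruct (continuous_bounded z 0 X) as [M [HM Hb]].
    { intros x _. now apply (airy_continuous z z'). }
    exists (Rabs (z 0) + Rabs (z' 0) + X * M).
    intros D D' e eta HD HD' He H0 H1.
    destruct (mean_value (wronskian z z' D D') (fun x => z x * e x) 0 X HX) as [t [Ht E]].
    { intros x _. destruct (Hz x). eapply is_derive_eq; [apply wronskian_derive; eauto|]. ring. }
    specialize (Hb t ltac:(lra)). specialize (He t ltac:(lra)).
    assert (Heta : 0 <= eta) by (pose proof (Rabs_pos (D 0)); lra).
    replace (wronskian z z' D D' X) with
      (z 0 * D' 0 + - (z' 0 * D 0) + z t * e t * X) by (unfold wronskian in *; lra).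
    eapply Rle_trans; [apply Rabs_triang|].
    eapply Rle_trans; [apply Rplus_le_compat_r, Rabs_triang|].
    rewrite Rabs_Ropp, !Rabs_mult, (Rabs_pos_eq X) by lra.
    assert (Rabs (z 0) * Rabs (D' 0) <= Rabs (z 0) * eta)
      by (apply Rmult_le_compat_l; [apply Rabs_pos | easy]).
    assert (Rabs (z' 0) * Rabs (D 0) <= Rabs (z' 0) * eta)
      by (apply Rmult_le_compat_l; [apply Rabs_pos | easy]).
    assert (Rabs (z t) * Rabs (e t) <= M * eta)
      by (apply Rmult_le_compat; (apply Rabs_pos || easy)).
    nra. }
  destruct (B u u' (pair_u _ _ _ _ HP)) as [k1 Hk1].
  destruct (B A A' (pair_A _ _ _ _ HP)) as [k2 Hk2].
  pose proof airy_slope_pos as HW.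
  exists ((Rabs (u' X) * k2 + Rabs (A' X) * k1) / airy_slope).
  intros D D' e eta HD HD' He H0 H1.
  specialize (Hk1 D D' e eta HD HD' He H0 H1).
  specialize (Hk2 D D' e eta HD HD' He H0 H1).
  replace ((Rabs (u' X) * k2 + Rabs (A' X) * k1) / airy_slope * eta)
    with ((Rabs (u' X) * (k2 * eta) + Rabs (A' X) * (k1 * eta)) / airy_slope) by (field; lra).
  apply Rle_div_r; [easy|].
  rewrite <- (Rabs_pos_eq airy_slope) by lra. rewrite <- Rabs_mult.
  replace (D' X * airy_slope) with
    (u' X * wronskian A A' D D' X + - (A' X * wronskian u u' D D' X)).
  2:{ rewrite <- (pair_wronskian _ _ _ _ X HP). unfold wronskian. ring. }
  eapply Rle_trans; [apply Rabs_triang|]. rewrite Rabs_Ropp, !Rabs_mult.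
  apply Rplus_le_compat; apply Rmult_le_compat_l; (apply Rabs_pos || easy).
Qed.

Lemma weight_exp_lim X : is_lim (fun N => weight 3 N * exp (X * N)) p_infty 0.
Proof.
  apply (is_lim_le_le_loc (fun _ => 0) (fun N => exp (- N))).
  - exists (Rmax 1 (3 * (Rabs X + 1))). intros N HN.
    pose proof (Rmax_l 1 (3 * (Rabs X + 1))). pose proof (Rmax_r 1 (3 * (Rabs X + 1))).
    split; [left; apply Rmult_lt_0_compat; apply exp_pos|].
    unfold weight. rewrite <- exp_plus. apply exp_le_compat.
    pose proof (Rle_abs X). simpl. replace (1 + 1 + 1) with 3 by ring.
    assert (3 * (X + 1) <= N * N) by nra.
    assert (N * (3 * (X + 1)) <= N * (N * N)) by (apply Rmult_le_compat_l; lra).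
    lra.
  - apply is_lim_const.
  - apply (is_lim_comp exp Ropp p_infty 0 m_infty).
    + apply is_lim_exp_m.
    + apply (is_lim_opp (fun x => x) p_infty p_infty), is_lim_id.
    + exists 0. easy.
Qed.

(** As [f0''' = f0], one integration by parts shows that
    [int_0^oo exp (- r^3/3) f0 (x r) dr] solves the Airy equation; the limit here is
    its derivative.  Truncating at [N] keeps all integrals on compact intervals, at
    the price of a forcing term [- exp (- N^3/3) f2 (x N)], which
    [airy_perturbation] sends to 0. *)
Lemma airy_integral u u' A A' (f0 f1 f2 y y' : R -> R) (X : R) :
  airy_pair u u' A A' ->
  (forall t, is_derive f0 t (f1 t)) -> (forall t, is_derive f1 t (f2 t)) ->
  (forall t, is_derive f2 t (f0 t)) ->
  f2 0 = 0 -> (forall t, 0 <= t -> Rabs (f2 t) <= 2 * exp t) ->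
  airy y y' -> y 0 = f0 0 * full_moment 3 0 -> y' 0 = f1 0 * full_moment 3 1 ->
  0 < X ->
  is_lim (fun N => RInt (fun r => (r * weight 3 r) * f1 (X * r)) 0 N) p_infty (y' X).
Proof.
  intros HP F0 F1 F2 F20 F2b Hy Y0 Y1 HX.
  destruct (airy_perturbation _ _ _ _ X HP HX) as [K HK].
  set (U0 := fun N x => RInt (fun r => weight 3 r * f0 (x * r)) 0 N).
  set (U1 := fun N x => RInt (fun r => (r * weight 3 r) * f1 (x * r)) 0 N).
  set (U2 := fun N x => RInt (fun r => (r * (r * weight 3 r)) * f2 (x * r)) 0 N).
  assert (Cw : forall t, ex_derive (weight 3) t) by (intros; eexists; apply is_derive_weight).
  assert (DU : forall (p g g' : R -> R) N x, (forall t, ex_derive p t) ->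
     (forall t, is_derive g t (g' t)) -> (forall t, continuous g' t) ->
     is_derive (fun x => RInt (fun r => p r * g (x * r)) 0 N) x
       (RInt (fun r => (r * p r) * g' (x * r)) 0 N)).
  { intros p g g' N x Hp Hg Hg'.
    apply (is_derive_RInt_parameter (fun x r => p r * g (x * r))
             (fun x r => (r * p r) * g' (x * r)) (Rmin 0 N - 1)).
    - lra.
    - intros z t _. eapply is_derive_eq.
      + apply is_derive_scal. apply (is_derive_comp g (fun z => z * t)); [apply Hg|].
        apply (is_derive_mult (fun z => z) (fun _ => t)); [apply is_derive_id | apply is_derive_const|].
        intros; apply Rmult_comm.
      + unfold scal, plus, mult, one, zero; simpl; unfold mult; simpl. ring.
    - intros z t. 
      apply continuity_2d_pt_ext with (f := fun x r => 1 * ((r * p r) * g' (x * r))).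
      { intros; ring. }
      apply (continuity_2d_pt_product (fun _ => 1) (fun r => r * p r)).
      + apply continuous_const.
      + apply (ex_derive_continuous (V := R_NormedModule)).
        apply (ex_derive_mult (fun r => r) p); [apply ex_derive_id | apply Hp].
      + apply Hg'.
    - intros z t _. apply (ex_derive_continuous (V := R_NormedModule)).
      apply (ex_derive_mult p (fun r => g (z * r))); [apply Hp|].
      apply (ex_derive_comp g (fun r => z * r)); [eexists; apply Hg|]. auto_derive. easy. }
  assert (DU0 : forall N x, is_derive (U0 N) x (U1 N x)).
  { intros N x. apply DU; [exact Cw | exact F0 |]. intros t. eapply is_derive_continuous, F1. }
  assert (DU1 : forall N x, is_derive (U1 N) x (U2 N x)).
  { intros N x. apply (DU (fun r => r * weight 3 r) f1 f2).
    - intros t. apply (ex_derive_mult (fun r => r) (weight 3)); [apply ex_derive_id | apply Cw].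
    - exact F1.
    - intros t. eapply is_derive_continuous, F2. }
  assert (IBP : forall N x, 0 <= N -> U2 N x = x * U0 N x - weight 3 N * f2 (x * N)).
  { intros N x HN. unfold U2, U0.
    assert (C0 : ex_RInt (fun r => weight 3 r * f0 (x * r)) 0 N).
    { apply ex_RInt_cont. intros t _. apply (ex_derive_continuous (V := R_NormedModule)).
      apply (ex_derive_mult (weight 3) (fun r => f0 (x * r))); [apply Cw|].
      apply (ex_derive_comp f0 (fun r => x * r)); [eexists; apply F0|]. auto_derive. easy. }
    assert (C2 : forall t, continuous (fun r => (r * (r * weight 3 r)) * f2 (x * r)) t).
    { intros t. apply (ex_derive_continuous (V := R_NormedModule)).
      apply (ex_derive_mult (fun r => r * (r * weight 3 r)) (fun r => f2 (x * r))).
      - unfold weight. auto_derive. easy.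
      - apply (ex_derive_comp f2 (fun r => x * r)); [eexists; apply F2|]. auto_derive. easy. }
    assert (C0' : forall t, continuous (fun r => - x * (weight 3 r * f0 (x * r))) t).
    { intros t. apply (ex_derive_continuous (V := R_NormedModule)).
      apply (ex_derive_scal (fun r => weight 3 r * f0 (x * r))).
      apply (ex_derive_mult (weight 3) (fun r => f0 (x * r))); [apply Cw|].
      apply (ex_derive_comp f0 (fun r => x * r)); [eexists; apply F0|]. auto_derive. easy. }
    assert (E : RInt (fun r => (r * (r * weight 3 r)) * f2 (x * r)
                  + - x * (weight 3 r * f0 (x * r))) 0 N
              = - (weight 3 N * f2 (x * N)) - - (weight 3 0 * f2 (x * 0))).
    { apply (RInt_of_antiderivative _ (fun r => - (weight 3 r * f2 (x * r)))); [easy| |].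
      - intros r _. eapply is_derive_eq.
        + apply (is_derive_opp (fun r => weight 3 r * f2 (x * r))).
          apply (is_derive_mult (weight 3) (fun r => f2 (x * r))).
          * apply is_derive_weight.
          * apply (is_derive_comp f2 (fun r => x * r)); [apply F2|].
            apply is_derive_scal. apply is_derive_id.
          * intros; apply Rmult_comm.
        + unfold opp, scal, plus, mult, one, zero; simpl; unfold mult; simpl. ring.
      - intros r _. apply (continuous_plus (V := R_NormedModule)); auto. }
    rewrite RInt_plus_R, RInt_mult_const in E; auto.
    - rewrite Rmult_0_r, F20 in E. lra.
    - apply ex_RInt_cont; auto.
    - apply ex_RInt_cont; auto. }
  set (eta := fun N => 2 * (weight 3 N * exp (X * N))
      + (Rabs (f0 0) * (full_moment 3 0 - moment 3 0 N)
         + Rabs (f1 0) * (full_moment 3 1 - moment 3 1 N))).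
  assert (Heta : is_lim eta p_infty 0).
  { unfold eta.
    replace (Finite 0) with (Finite (2 * 0 + (Rabs (f0 0) * (full_moment 3 0 - full_moment 3 0)
         + Rabs (f1 0) * (full_moment 3 1 - full_moment 3 1)))) by (f_equal; ring).
    apply is_lim_plus'; [|apply is_lim_plus'].
    - apply (is_lim_scal_l _ 2 p_infty 0). apply weight_exp_lim.
    - apply (is_lim_scal_l _ (Rabs (f0 0)) p_infty (full_moment 3 0 - full_moment 3 0)).
      apply is_lim_minus'; [apply is_lim_const | apply (full_moment_spec 0 1)].
    - apply (is_lim_scal_l _ (Rabs (f1 0)) p_infty (full_moment 3 1 - full_moment 3 1)).
      apply is_lim_minus'; [apply is_lim_const | apply (full_moment_spec 1 0)]. }
  assert (Hb : forall N, 0 <= N -> Rabs (U1 N X - y' X) <= K * eta N).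
  { intros N HN.
    pose proof (proj1 (proj2 (full_moment_spec 0 1)) N HN) as G0.
    pose proof (proj1 (proj2 (full_moment_spec 1 0)) N HN) as G1.
    simpl in G0, G1.
    pose proof (Rabs_pos (f0 0)). pose proof (Rabs_pos (f1 0)).
    assert (E1 : 0 <= Rabs (f0 0) * (full_moment 3 0 - moment 3 0 N)) by (apply Rmult_le_pos; lra).
    assert (E2 : 0 <= Rabs (f1 0) * (full_moment 3 1 - moment 3 1 N)) by (apply Rmult_le_pos; lra).
    assert (E3 : 0 <= weight 3 N * exp (X * N)) by (left; apply Rmult_lt_0_compat; apply exp_pos).
    apply (HK (fun x => U0 N x - y x) (fun x => U1 N x - y' x)
             (fun x => - (weight 3 N * f2 (x * N)))).
    - intros x. apply (is_derive_minus (U0 N) y); [apply DU0 | apply Hy].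
    - intros x. eapply is_derive_eq.
      + apply (is_derive_minus (U1 N) y'); [apply DU1 | apply Hy].
      + rewrite IBP by easy. unfold minus, plus, opp; simpl. ring.
    - intros x Hx. rewrite Rabs_Ropp, Rabs_mult, Rabs_pos_eq by (left; apply weight_pos).
      apply Rle_trans with (weight 3 N * (2 * exp (X * N))).
      + apply Rmult_le_compat_l; [left; apply weight_pos|].
        eapply Rle_trans; [apply F2b; nra|].
        apply Rmult_le_compat_l; [lra|]. apply exp_le_compat. nra.
      + unfold eta. lra.
    - replace (U0 N 0 - y 0) with (- (f0 0 * (full_moment 3 0 - moment 3 0 N))).
      + rewrite Rabs_Ropp, Rabs_mult, (Rabs_pos_eq (_ - _)) by lra. unfold eta. lra.
      + unfold U0. rewrite Y0. unfold moment.
        rewrite (RInt_ext (fun r => weight 3 r * f0 (0 * r)) (fun r => f0 0 * (r ^ 0 * weight 3 r))).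
        * rewrite RInt_mult_const; [ring|].
          apply ex_RInt_cont; intros; apply continuous_pow_weight.
        * intros r _. change (weight 3 r * f0 (0 * r) = f0 0 * (1 * weight 3 r)).
          rewrite Rmult_0_l. ring.
    - replace (U1 N 0 - y' 0) with (- (f1 0 * (full_moment 3 1 - moment 3 1 N))).
      + rewrite Rabs_Ropp, Rabs_mult, (Rabs_pos_eq (_ - _)) by lra. unfold eta. lra.
      + unfold U1. rewrite Y1. unfold moment.
        rewrite (RInt_ext (fun r => r * weight 3 r * f1 (0 * r)) (fun r => f1 0 * (r ^ 1 * weight 3 r))).
        * rewrite RInt_mult_const; [ring|].
          apply ex_RInt_cont; intros; apply continuous_pow_weight.
        * intros r _. change (r * weight 3 r * f1 (0 * r) = f1 0 * (r * 1 * weight 3 r)).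
          rewrite Rmult_0_l. ring. }
  apply (is_lim_le_le_loc (fun N => y' X - K * eta N) (fun N => y' X + K * eta N)).
  - exists 0. intros N HN. specialize (Hb N ltac:(lra)).
    apply Rabs_le_between in Hb. unfold U1 in Hb. lra.
  - replace (Finite (y' X)) with (Finite (y' X - K * 0)) by (f_equal; ring).
    apply is_lim_minus'; [apply is_lim_const|].
    apply (is_lim_scal_l _ K p_infty 0 Heta).
  - replace (Finite (y' X)) with (Finite (y' X + K * 0)) by (f_equal; ring).
    apply is_lim_plus'; [apply is_lim_const|].
    apply (is_lim_scal_l _ K p_infty 0 Heta).
Qed.

(** * Integral representations of the two solutions *)

Definition damped_cos (t : R) : R := exp (- t / 2) * cos (sqrt 3 * t / 2).
Definition damped_sin (t : R) : R := exp (- t / 2) * sin (sqrt 3 * t / 2).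

Lemma is_derive_damped_cos t :
  is_derive damped_cos t (- damped_cos t / 2 - sqrt 3 * damped_sin t / 2).
Proof. unfold damped_cos, damped_sin. auto_derive; [easy|]. unfold Rdiv. ring. Qed.

Lemma is_derive_damped_sin t :
  is_derive damped_sin t (- damped_sin t / 2 + sqrt 3 * damped_cos t / 2).
Proof. unfold damped_cos, damped_sin. auto_derive; [easy|]. unfold Rdiv. ring. Qed.

Lemma damped_bounds t : 0 <= t -> Rabs (damped_cos t) <= 1 /\ Rabs (damped_sin t) <= 1.
Proof.
  intros Ht. unfold damped_cos, damped_sin.
  assert (exp (- t / 2) <= 1) by (rewrite <- exp_0; apply exp_le_compat; lra).
  pose proof (exp_pos (- t / 2)).
  rewrite !Rabs_mult, (Rabs_pos_eq (exp _)) by lra.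
  pose proof (COS_bound (sqrt 3 * t / 2)). pose proof (SIN_bound (sqrt 3 * t / 2)).
  split; rewrite <- (Rmult_1_r 1); apply Rmult_le_compat;
    (lra || apply Rabs_pos || (apply Rabs_le; lra)).
Qed.

Lemma damped_0 : damped_cos 0 = 1 /\ damped_sin 0 = 0.
Proof.
  unfold damped_cos, damped_sin. replace (- 0 / 2) with 0 by field.
  replace (sqrt 3 * 0 / 2) with 0 by field. rewrite exp_0, cos_0, sin_0. lra.
Qed.

Lemma sqrt3_spec : sqrt 3 * sqrt 3 = 3 /\ 1 < sqrt 3 < 2.
Proof.
  assert (H : sqrt 3 * sqrt 3 = 3) by (apply sqrt_sqrt; lra).
  pose proof (sqrt_pos 3). split; [easy|]. nra.
Qed.

(** Closed forms of the three sections of the exponential series, over the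
    exponents congruent to [0], [2] and [1] modulo 3 respectively. *)
Definition exp3_0 (t : R) : R := (exp t + 2 * damped_cos t) / 3.
Definition exp3_1 (t : R) : R := (exp t - damped_cos t - sqrt 3 * damped_sin t) / 3.
Definition exp3_2 (t : R) : R := (exp t - damped_cos t + sqrt 3 * damped_sin t) / 3.

Lemma is_derive_exp3_combination (a b c t : R) :
  is_derive (fun t => (a * exp t + b * damped_cos t + c * damped_sin t) / 3) t
    ((a * exp t + b * (- damped_cos t / 2 - sqrt 3 * damped_sin t / 2)
       + c * (- damped_sin t / 2 + sqrt 3 * damped_cos t / 2)) / 3).
Proof.
  pose proof (is_derive_damped_cos t) as Hc. pose proof (is_derive_damped_sin t) as Hs.
  auto_derive.
  - repeat split; eexists; eassumption.
  - replace (Derive (fun x : R => damped_cos x) t) with (- damped_cos t / 2 - sqrt 3 * damped_sin t / 2)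
      by (symmetry; apply is_derive_unique, Hc).
    replace (Derive (fun x : R => damped_sin x) t) with (- damped_sin t / 2 + sqrt 3 * damped_cos t / 2)
      by (symmetry; apply is_derive_unique, Hs).
    unfold Rdiv. ring.
Qed.

Lemma exp3_cycle t :
  is_derive exp3_0 t (exp3_1 t) /\ is_derive exp3_1 t (exp3_2 t) /\
  is_derive exp3_2 t (exp3_0 t).
Proof.
  destruct sqrt3_spec as [E _]. unfold exp3_0, exp3_1, exp3_2.
  split; [|split].
  - eapply is_derive_ext; [|eapply is_derive_eq; [apply (is_derive_exp3_combination 1 2 0)|]].
    + intros; simpl; field.
    + field.
  - eapply is_derive_ext; [|eapply is_derive_eq; [apply (is_derive_exp3_combination 1 (-1) (- sqrt 3))|]].
    + intros; simpl; field.
    + field_simplify. replace (sqrt 3 ^ 2) with 3 by (simpl; lra). field.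
  - eapply is_derive_ext; [|eapply is_derive_eq; [apply (is_derive_exp3_combination 1 (-1) (sqrt 3))|]].
    + intros; simpl; field.
    + field_simplify. replace (sqrt 3 ^ 2) with 3 by (simpl; lra). field.
Qed.

Lemma continuous_of_derivable (f : R -> R) :
  (forall t, ex_derive f t) -> forall t, continuous f t.
Proof. intros H t. apply (ex_derive_continuous (V := R_NormedModule)), H. Qed.

Lemma abs_RInt_le_RInt (f g : R -> R) (a b : R) :
  a <= b -> ex_RInt f a b -> ex_RInt g a b ->
  (forall x, a <= x <= b -> Rabs (f x) <= g x) -> Rabs (RInt f a b) <= RInt g a b.
Proof.
  intros Hab Hf Hg H.
  apply (norm_RInt_le (V := R_NormedModule) f g a b (RInt f a b) (RInt g a b) Hab H);
    now apply (RInt_correct (V := R_CompleteNormedModule)).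
Qed.

Lemma RInt_moment_bound (f : R -> R) (X C N : R) :
  0 < X -> 0 <= N -> (forall t, ex_derive f t) ->
  (forall t, 0 <= t -> Rabs (f t) <= C) ->
  Rabs (RInt (fun r => (r * weight 3 r) * f (X * r)) 0 N) <= C * full_moment 3 1.
Proof.
  intros HX HN Hf Hb.
  assert (HC : 0 <= C) by (pose proof (Hb 0 ltac:(lra)); pose proof (Rabs_pos (f 0)); lra).
  assert (C1 : forall t, continuous (fun r => (r * weight 3 r) * f (X * r)) t).
  { apply continuous_of_derivable. intros t.
    apply (ex_derive_mult (fun r => r * weight 3 r) (fun r => f (X * r))).
    - unfold weight. auto_derive. easy.
    - apply (ex_derive_comp f (fun r => X * r)); [apply Hf|]. auto_derive. easy. }
  eapply Rle_trans.
  { apply (abs_RInt_le_RInt _ (fun r => C * (r ^ 1 * weight 3 r)) 0 N).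
    - easy.
    - apply ex_RInt_cont; auto.
    - apply ex_RInt_cont. intros; apply continuous_of_derivable.
      intros. unfold weight. auto_derive. easy.
    - intros r Hr. change (Rabs (r * weight 3 r * f (X * r)) <= C * (r ^ 1 * weight 3 r)).
      pose proof (weight_pos 3 r).
      rewrite !Rabs_mult, (Rabs_pos_eq r), (Rabs_pos_eq (weight 3 r)) by lra.
      specialize (Hb (X * r) ltac:(nra)).
      rewrite pow_1, (Rmult_comm C). apply Rmult_le_compat_l; [|easy].
      apply Rmult_le_pos; lra. }
  rewrite RInt_mult_const by (apply ex_RInt_cont; intros; apply continuous_pow_weight).
  apply Rmult_le_compat_l; [easy|]. apply (full_moment_spec 1 0). easy.
Qed.

Lemma is_lim_Rabs_le (f : R -> R) (l C : R) :
  is_lim f p_infty l -> (exists M, forall N, M < N -> Rabs (f N) <= C) -> Rabs l <= C.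
Proof.
  intros Hl [M HM]. apply Rabs_le. split.
  - apply (is_lim_le_loc (fun _ => - C) f p_infty (- C) l); [|apply is_lim_const | exact Hl].
    exists M. intros N HN. specialize (HM N HN). now apply Rabs_le_between in HM.
  - apply (is_lim_le_loc f (fun _ => C) p_infty l C); [|exact Hl | apply is_lim_const].
    exists M. intros N HN. specialize (HM N HN). now apply Rabs_le_between in HM.
Qed.

Lemma airy_scal_pair u u' A A' k : airy_pair u u' A A' ->
  airy (fun x => k * u x) (fun x => k * u' x) /\ airy (fun x => k * A x) (fun x => k * A' x).
Proof. intros [Hu HA _ _ _ _]. split; now apply airy_scal. Qed.

(** In [exp3_0 - exp3_2] the growing exponential cancels, so the solution that it
    represents has a bounded derivative; its initial values are those of
    [full_moment 3 0 * A].  This is where the Gamma values in the definition of Ai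
    are used. *)
Lemma pair_A'_bounded u u' A A' X : airy_pair u u' A A' -> 0 < X ->
  Rabs (A' X) <= 2 * airy_slope.
Proof.
  intros HP HX. destruct full_moment_pos as [G0 G1]. destruct sqrt3_spec as [S3 S3b].
  destruct damped_0 as [C0 S0].
  assert (H : Rabs (full_moment 3 0 * A' X) <= 2 * full_moment 3 1).
  { eapply is_lim_Rabs_le.
    - apply (airy_integral u u' A A' (fun t => exp3_0 t - exp3_2 t)
       (fun t => exp3_1 t - exp3_0 t) (fun t => exp3_2 t - exp3_1 t)
       (fun x => full_moment 3 0 * A x) (fun x => full_moment 3 0 * A' x)); auto.
      + intros t. apply (is_derive_minus exp3_0 exp3_2); apply exp3_cycle.
      + intros t. apply (is_derive_minus exp3_1 exp3_0); apply exp3_cycle.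
      + intros t. apply (is_derive_minus exp3_2 exp3_1); apply exp3_cycle.
      + unfold exp3_1, exp3_2. rewrite C0, S0. field.
      + intros t Ht. unfold exp3_1, exp3_2.
        destruct (damped_bounds t Ht) as [_ B].
        pose proof (exp_ineq1_le t). apply Rabs_le_between in B. apply Rabs_le. nra.
      + now apply (airy_scal_pair u u' A A').
      + unfold exp3_0, exp3_2. rewrite (pair_A0 _ _ _ _ HP), C0, S0, exp_0. field.
      + unfold exp3_0, exp3_1. rewrite (pair_A'0 _ _ _ _ HP), C0, S0, exp_0.
        unfold airy_slope. field. lra.
    - exists 0. intros N HN. apply (RInt_moment_bound (fun t => exp3_1 t - exp3_0 t)); auto; [lra| |].
      + intros t. apply (ex_derive_minus exp3_1 exp3_0); eexists; apply exp3_cycle.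
      + intros t Ht. unfold exp3_0, exp3_1. destruct (damped_bounds t Ht) as [B1 B2].
        apply Rabs_le_between in B1. apply Rabs_le_between in B2. apply Rabs_le. nra. }
  rewrite Rabs_mult, (Rabs_pos_eq (full_moment 3 0)) in H by lra.
  unfold airy_slope. apply (Rmult_le_reg_l (full_moment 3 0)); [easy|].
  eapply Rle_trans; [exact H|]. right. field. lra.
Qed.

Definition laplace_integral (x N : R) : R :=
  RInt (fun r => (r * weight 3 r) * exp (x * r)) 0 N.

(** * Laplace's method *)

Lemma exp_minus_1_bound (a b : R) : a <= b -> 0 <= b -> Rabs (exp a - 1) <= Rabs a * exp b.
Proof.
  intros Hab Hb. pose proof (exp_pos a) as Ea. pose proof (Rabs_pos a).
  assert (Eb : 1 <= exp b) by (rewrite <- exp_0; now apply exp_le_compat).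
  pose proof (exp_le_compat a b Hab).
  pose proof (Rle_abs a). pose proof (Rle_abs (- a)) as Hm. rewrite Rabs_Ropp in Hm.
  apply Rabs_le. split.
  - pose proof (exp_ineq1_le a). nra.
  - pose proof (exp_ineq1_le (- a)) as E. rewrite exp_Ropp in E.
    assert ((1 + - a) * exp a <= 1).
    { apply Rmult_le_compat_r with (r := exp a) in E; [|lra].
      rewrite Rinv_l in E by lra. exact E. }
    assert (a * exp a <= Rabs a * exp b); [|lra].
    apply Rle_trans with (Rabs a * exp a); [apply Rmult_le_compat_r; lra|].
    apply Rmult_le_compat_l; lra.
Qed.

(** The integrand around its saddle, rescaled so that its Gaussian part is
    standard; [eps] is the size of the cubic correction. *)
Definition saddle_integrand (eps s : R) : R :=
  (1 + eps * s) * exp (- (s ^ 2 / 2) - eps * s ^ 3 / 6).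

(** The hypothesis on [eps * s] says that [s] stays on the side [r >= 0] of the
    original integral; there the cubic term is at most [s^2 / 6] and is absorbed by
    the Gaussian.  The error is compared with [/ (1 + s ^ 2)] because the latter
    has a bounded primitive. *)
Lemma saddle_integrand_error eps s : 0 < eps -> - 1 <= eps * s ->
  Rabs (saddle_integrand eps s - exp (- (s ^ 2 / 2))) <= 61 * eps * / (1 + s ^ 2).
Proof.
  intros He Hs. unfold saddle_integrand.
  set (a := - (eps * s ^ 3 / 6)). set (b := s ^ 2 / 6).
  assert (S2 : 0 <= s ^ 2) by (simpl; nra).
  assert (Hb : 0 <= b) by (unfold b; lra).
  assert (Hab : a <= b).
  { unfold a, b. replace (s ^ 3) with (s * s ^ 2) by ring. nra. }
  replace (- (s ^ 2 / 2) - eps * s ^ 3 / 6) with (- (s ^ 2 / 2) + a) by (unfold a; ring).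
  rewrite exp_plus.
  replace ((1 + eps * s) * (exp (- (s ^ 2 / 2)) * exp a) - exp (- (s ^ 2 / 2)))
    with (exp (- (s ^ 2 / 2)) * (eps * s * exp a + (exp a - 1))) by ring.
  rewrite Rabs_mult, (Rabs_pos_eq (exp _)) by (left; apply exp_pos).
  set (m := Rabs s).
  assert (Hm : 0 <= m) by apply Rabs_pos.
  assert (Hm2 : m ^ 2 = s ^ 2) by (unfold m; now rewrite pow2_abs).
  assert (Ha : Rabs a = eps * m ^ 3 / 6).
  { unfold a, m. rewrite Rabs_Ropp. unfold Rdiv. rewrite !Rabs_mult.
    rewrite (Rabs_pos_eq eps), (Rabs_pos_eq (/ 6)) by lra. now rewrite RPow_abs. }
  assert (B1 : Rabs (eps * s * exp a + (exp a - 1)) <= eps * (m + m ^ 3 / 6) * exp b).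
  { eapply Rle_trans; [apply Rabs_triang|].
    replace (eps * (m + m ^ 3 / 6) * exp b)
      with (eps * m * exp b + eps * m ^ 3 / 6 * exp b) by field.
    apply Rplus_le_compat.
    - rewrite !Rabs_mult, (Rabs_pos_eq eps), (Rabs_pos_eq (exp a)) by (try (left; apply exp_pos); lra).
      apply Rmult_le_compat_l; [fold m; nra|]. now apply exp_le_compat.
    - rewrite <- Ha. now apply exp_minus_1_bound. }
  eapply Rle_trans.
  { apply Rmult_le_compat_l; [left; apply exp_pos | exact B1]. }
  replace (exp (- (s ^ 2 / 2)) * (eps * (m + m ^ 3 / 6) * exp b))
    with (eps * (m + m ^ 3 / 6) * exp (- (s ^ 2 / 3))).
  2:{ replace (- (s ^ 2 / 3)) with (- (s ^ 2 / 2) + b) by (unfold b; field).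
      rewrite exp_plus. ring. }
  rewrite exp_Ropp.
  pose proof (exp_ge_cube (s ^ 2 / 3) ltac:(lra)) as E.
  pose proof (exp_pos (s ^ 2 / 3)).
  apply (Rmult_le_reg_r (exp (s ^ 2 / 3))); [easy|].
  rewrite Rmult_assoc, Rinv_l, Rmult_1_r by lra.
  apply (Rmult_le_reg_r (1 + s ^ 2)); [lra|].
  replace (61 * eps * / (1 + s ^ 2) * exp (s ^ 2 / 3) * (1 + s ^ 2))
    with (eps * (61 * exp (s ^ 2 / 3))) by (field; lra).
  rewrite (Rmult_assoc eps). apply Rmult_le_compat_l; [lra|].
  apply Rle_trans with (61 * (1 + s ^ 2 / 3 / 3) ^ 3); [|lra].
  rewrite <- Hm2. 
  set (y := 1 + m ^ 2 / 3 / 3).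
  pose proof (pow2_ge_0 m) as M2. pose proof (pow2_ge_0 (m - 1)) as M3.
  assert (Y1 : 1 <= y) by (unfold y; lra).
  assert (P1 : m <= (1 + m ^ 2) / 2) by (simpl in *; lra).
  assert (P2 : m + m ^ 3 / 6 <= (1 + m ^ 2) / 2 * (1 + m ^ 2 / 6)).
  { replace (m + m ^ 3 / 6) with (m * (1 + m ^ 2 / 6)) by field.
    apply Rmult_le_compat_r; [lra | easy]. }
  (* the product of the constants, 243 / 4, is rounded up to 61 *)
  apply Rle_trans with ((9 * y / 2 * (3 / 2 * y)) * (9 * y)).
  - apply Rmult_le_compat; [|lra| |unfold y; lra].
    + assert (0 <= m ^ 3) by (apply pow_le; easy). lra.
    + eapply Rle_trans; [exact P2|]. apply Rmult_le_compat; unfold y; lra.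
  - replace (9 * y / 2 * (3 / 2 * y) * (9 * y)) with (243 / 4 * y ^ 3) by field.
    assert (0 <= y ^ 3) by (apply pow_le; lra). lra.
Qed.

Lemma weight2_eq s : weight 2 s = exp (- (s ^ 2 / 2)).
Proof. unfold weight. simpl. f_equal. Qed.

Lemma gaussian_moment_odd y : moment 2 0 (- y) = - moment 2 0 y.
Proof.
  assert (H : forall z, is_derive (fun z => moment 2 0 z + moment 2 0 (- z)) z 0).
  { intros z. eapply is_derive_eq.
    - apply (is_derive_plus (moment 2 0) (fun z => moment 2 0 (- z))).
      + apply is_derive_moment.
      + apply (is_derive_comp (moment 2 0) Ropp); [apply is_derive_moment|].
        instantiate (1 := -1). auto_derive; [easy | ring].
    - unfold plus, scal, opp, one; simpl; unfold mult; simpl. rewrite !weight2_eq.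
      replace ((- z) ^ 2) with (z ^ 2) by ring. ring. }
  assert (E : moment 2 0 0 + moment 2 0 (- 0) = moment 2 0 y + moment 2 0 (- y)).
  { destruct (Rle_dec 0 y).
    - apply (derive_zero_eq (fun z => moment 2 0 z + moment 2 0 (- z))); auto.
    - symmetry. apply (derive_zero_eq (fun z => moment 2 0 z + moment 2 0 (- z))); [lra | auto]. }
  rewrite Ropp_0, moment_0 in E. lra.
Qed.

Lemma gaussian_tail y : 0 < y -> 0 <= sqrt (PI / 2) - moment 2 0 y <= 4 / y ^ 2.
Proof.
  intros Hy. rewrite <- gaussian_moment.
  pose proof (proj1 (proj2 (full_moment_spec 0 0)) y ltac:(lra)) as Hle.
  pose proof (moment_product_error 0 0 y ltac:(lra)) as [_ H].
  rewrite <- (full_moment_product 0 0) in H. simpl Nat.add in *.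
  assert (HG : 1 <= full_moment 2 0).
  { rewrite gaussian_moment. rewrite <- sqrt_1. apply sqrt_le_1_alt.
    pose proof PI2_1. lra. }
  pose proof (moment_pos 2 0 y Hy).
  assert (Hw : weight 2 y <= 2 / y ^ 2).
  { rewrite weight2_eq, exp_Ropp. pose proof (exp_ineq1_le (y ^ 2 / 2)).
    assert (0 < y ^ 2) by (apply pow_lt; easy).
    replace (2 / y ^ 2) with (/ (y ^ 2 / 2)) by (field; lra).
    apply Rinv_le_contravar; lra. }
  split; [lra|].
  replace (4 / y ^ 2) with (2 * (2 / y ^ 2)) by (field; lra).
  nra.
Qed.

Lemma saddle_integral eps M : 0 < eps <= 1 -> 0 < M ->
  Rabs (RInt (saddle_integrand eps) (- / eps) M - (moment 2 0 M + sqrt (PI / 2)))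
  <= 248 * eps.
Proof.
  intros He HM.
  assert (Hi : 0 < / eps) by (apply Rinv_0_lt_compat; lra).
  assert (C1 : forall t, continuous (saddle_integrand eps) t).
  { apply continuous_of_derivable. intros t. unfold saddle_integrand. auto_derive. easy. }
  assert (C2 : forall t, continuous (fun s => exp (- (s ^ 2 / 2))) t).
  { apply continuous_of_derivable. intros t. auto_derive. easy. }
  assert (E2 : RInt (fun s => exp (- (s ^ 2 / 2))) (- / eps) M = moment 2 0 M + moment 2 0 (/ eps)).
  { rewrite (RInt_of_antiderivative _ (moment 2 0)); [|lra| |auto].
    - rewrite gaussian_moment_odd. unfold Rminus. now rewrite Ropp_involutive.
    - intros x _. eapply is_derive_eq; [apply is_derive_moment|].
      rewrite weight2_eq. simpl. ring. }
  assert (E3 : Rabs (RInt (fun s => saddle_integrand eps s - exp (- (s ^ 2 / 2))) (- / eps) M)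
                <= 244 * eps).
  { assert (C3 : forall t, continuous (fun s => 61 * eps * / (1 + s ^ 2)) t).
    { apply continuous_of_derivable. intros t. auto_derive. nra. }
    eapply Rle_trans.
    { apply (abs_RInt_le_RInt _ (fun s => 61 * eps * / (1 + s ^ 2)) (- / eps) M).
      - lra.
      - apply ex_RInt_cont.
        intros t _. apply (continuous_minus (V := R_NormedModule)); auto.
      - apply ex_RInt_cont. auto.
      - intros s Hs. apply saddle_integrand_error; [lra|].
        replace (- 1) with (eps * - / eps) by (field; lra).
        apply Rmult_le_compat_l; lra. }
    rewrite (RInt_of_antiderivative _ (fun s => 61 * eps * atan s)); [|lra| |auto].
    - pose proof (atan_bound M). pose proof (atan_bound (- / eps)). pose proof PI_4. nra.
    - intros x _. auto_derive; [easy|]. field. nra. }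
  assert (E4 : RInt (fun s => saddle_integrand eps s - exp (- (s ^ 2 / 2))) (- / eps) M
      = RInt (saddle_integrand eps) (- / eps) M - (moment 2 0 M + moment 2 0 (/ eps))).
  { rewrite <- E2. apply (RInt_minus (V := R_CompleteNormedModule)); apply ex_RInt_cont; auto. }
  rewrite E4 in E3. apply Rabs_le_between in E3.
  pose proof (gaussian_tail (/ eps) Hi) as T.
  replace (4 / (/ eps) ^ 2) with (4 * (eps * eps)) in T by (field; lra).
  apply Rabs_le. nra.
Qed.

(** The substitution [r = q + s t] at the saddle [r = q] of [q^2 r - r^3/3]; the
    step [s] makes the quadratic part [- t^2 / 2], and then the relative size of
    the cubic part is [s / q]. *)
Lemma laplace_integral_saddle q N (s := / sqrt (2 * q)) :
  0 < q ->
  laplace_integral (q ^ 2) N =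
  s * q * exp (2 / 3 * q ^ 3) * RInt (saddle_integrand (s / q)) (- / (s / q)) ((N - q) / s).
Proof.
  intros Hq.
  assert (Hs : 0 < s) by (apply Rinv_0_lt_compat, sqrt_lt_R0; lra).
  assert (Hs2 : s * s = / (2 * q)).
  { unfold s. rewrite <- Rinv_mult, sqrt_sqrt by lra. easy. }
  clearbody s.
  assert (Hs2' : s ^ 2 * q = 1 / 2).
  { replace (s ^ 2 * q) with (s * s * q) by ring. rewrite Hs2. field. lra. }
  assert (Hq0 : s <> 0 /\ q <> 0) by lra.
  set (f := fun r => (r * weight 3 r) * exp (q ^ 2 * r)).
  assert (Cf : forall t, continuous f t).
  { apply continuous_of_derivable. intros t. unfold f, weight. auto_derive. easy. }
  assert (Cs : forall t, continuous (saddle_integrand (s / q)) t).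
  { apply continuous_of_derivable. intros t. unfold saddle_integrand. auto_derive. easy. }
  assert (Ea : s * (- / (s / q)) + q = 0) by (field; lra).
  assert (Eb : s * ((N - q) / s) + q = N) by (field; lra).
  pose proof (RInt_comp_lin (V := R_CompleteNormedModule) f s q (- / (s / q)) ((N - q) / s)) as H.
  rewrite Ea, Eb in H.
  unfold laplace_integral. fold f. rewrite <- H by (apply ex_RInt_cont; auto).
  rewrite <- RInt_mult_const by (apply ex_RInt_cont; auto).
  apply RInt_ext. intros t _.
  change (s * f (s * t + q) = s * q * exp (2 / 3 * q ^ 3) * saddle_integrand (s / q) t).
  unfold f, saddle_integrand, weight. simpl INR.
  set (c := - ((s * t + q) ^ 3 / (1 + 1 + 1))). set (d := q ^ 2 * (s * t + q)).
  set (c' := 2 / 3 * q ^ 3). set (d' := - (t ^ 2 / 2) - s / q * t ^ 3 / 6).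
  transitivity (s * (s * t + q) * exp (c + d)); [rewrite exp_plus; ring|].
  transitivity (s * (s * t + q) * exp (c' + d')); [|rewrite exp_plus; field; lra].
  f_equal. f_equal. unfold c, d, c', d'.
  replace (s / q * t ^ 3 / 6) with (s ^ 3 * t ^ 3 / 3).
  2:{ replace (s ^ 3) with (s * (s * s)) by ring. rewrite Hs2. field. lra. }
  replace (t ^ 2 / 2) with (s ^ 2 * q * t ^ 2) by (rewrite Hs2'; field).
  field.
Qed.

Lemma laplace_integral_error q N (s := / sqrt (2 * q)) :
  1 <= q -> q < N ->
  Rabs (laplace_integral (q ^ 2) N
        - s * q * exp (2 / 3 * q ^ 3) * (moment 2 0 ((N - q) / s) + sqrt (PI / 2)))
  <= s * q * exp (2 / 3 * q ^ 3) * (248 / q).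
Proof.
  intros Hq HN. rewrite laplace_integral_saddle by lra. fold s.
  assert (Hs : 0 < s) by (apply Rinv_0_lt_compat, sqrt_lt_R0; lra).
  assert (Hs1 : s <= 1).
  { unfold s. rewrite <- Rinv_1. apply Rinv_le_contravar; [lra|].
    rewrite <- sqrt_1. apply sqrt_le_1_alt. lra. }
  assert (He : 0 < s / q <= 1).
  { split; [apply Rdiv_lt_0_compat; lra | apply Rle_div_l; lra]. }
  assert (Hl : s / q <= 1 / q) by (apply Rmult_le_compat_r; [left; apply Rinv_0_lt_compat|]; lra).
  set (a := s * q * exp (2 / 3 * q ^ 3)).
  assert (Ha : 0 < a).
  { apply Rmult_lt_0_compat; [apply Rmult_lt_0_compat; lra | apply exp_pos]. }
  rewrite <- Rmult_minus_distr_l, Rabs_mult, (Rabs_pos_eq a) by lra.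
  apply Rmult_le_compat_l; [lra|].
  eapply Rle_trans.
  - apply saddle_integral; [exact He|]. apply Rdiv_lt_0_compat; lra.
  - lra.
Qed.

(** With [x = q ^ 2] this is the familiar [x^(1/4) exp (2/3 x^(3/2))]. *)
Definition growth (q : R) : R := sqrt q * exp (2 / 3 * q ^ 3).

Lemma growth_ge q : 1 <= q -> q <= growth q.
Proof.
  intros Hq. unfold growth.
  assert (1 <= sqrt q) by (rewrite <- sqrt_1; apply sqrt_le_1_alt; easy).
  assert (q <= exp (2 / 3 * q ^ 3)).
  { eapply Rle_trans; [|apply exp_ineq1_le].
    assert (q * 1 <= q * (q * q)) by (apply Rmult_le_compat_l; nra).
    simpl. nra. }
  nra.
Qed.

Definition growth_amplitude : R := sqrt PI / (3 * full_moment 3 0).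

Lemma growth_amplitude_pos : 0 < growth_amplitude.
Proof.
  destruct full_moment_pos. apply Rdiv_lt_0_compat; [apply sqrt_lt_R0, PI_RGT_0 | lra].
Qed.

(** [full_moment 3 0 * u' (q ^ 2)] is the integral of [r exp (- r^3/3) exp3_1 (q^2 r)];
    up to a bounded error [exp3_1] is a third of the exponential, to which Laplace's
    method applies. *)
Lemma pair_u'_asymptotics u u' A A' : airy_pair u u' A A' ->
  exists K, 0 < K /\ forall q, 1 <= q ->
    Rabs (u' (q ^ 2) - growth_amplitude * growth q) <= K / q * growth q.
Proof.
  intros HP. destruct full_moment_pos as [G0 G1]. destruct sqrt3_spec as [S3 S3b].
  destruct damped_0 as [C0 S0].
  set (g0 := full_moment 3 0) in *. set (g1 := full_moment 3 1) in *.
  exists ((g1 + 248 / 3) / g0). split; [apply Rdiv_lt_0_compat; lra|].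
  intros q Hq.
  assert (HX : 0 < q ^ 2) by (apply pow_lt; lra).
  set (s := / sqrt (2 * q)).
  assert (Hs : 0 < s) by (apply Rinv_0_lt_compat, sqrt_lt_R0; lra).
  set (E := exp (2 / 3 * q ^ 3)).
  assert (HE : 0 < E) by apply exp_pos.
  assert (Hsq : s * q <= sqrt q).
  { assert (sqrt q * sqrt q = q) by (apply sqrt_sqrt; lra).
    assert (0 < sqrt q) by (apply sqrt_lt_R0; lra).
    assert (1 <= sqrt 2) by (rewrite <- sqrt_1; apply sqrt_le_1_alt; lra).
    unfold s. rewrite sqrt_mult by lra. rewrite Rmult_comm.
    apply Rle_div_l; [nra|]. nra. }
  assert (Hsp : s * q * (2 * sqrt (PI / 2)) = sqrt q * sqrt PI).
  { assert (sqrt q * sqrt q = q) by (apply sqrt_sqrt; lra).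
    assert (0 < sqrt q) by (apply sqrt_lt_R0; lra).
    assert (sqrt 2 * sqrt 2 = 2) by (apply sqrt_sqrt; lra).
    assert (0 < sqrt 2) by (apply sqrt_lt_R0; lra).
    pose proof PI_RGT_0.
    unfold s. rewrite sqrt_mult by lra. rewrite sqrt_div by lra.
    apply (Rmult_eq_reg_r (sqrt 2 * sqrt 2 * sqrt q)); [|nra].
    transitivity (q * 2 * sqrt PI); [field; lra|].
    transitivity (sqrt q * sqrt q * (sqrt 2 * sqrt 2) * sqrt PI); [rewrite H, H1; ring | ring]. }
  set (target := s * q * E * (2 * sqrt (PI / 2))).
  assert (Hlim : is_lim (fun N => RInt (fun r => (r * weight 3 r) * exp3_1 (q ^ 2 * r)) 0 N
      - / 3 * (s * q * E * (moment 2 0 ((N - q) / s) + sqrt (PI / 2)))) p_infty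
      (g0 * u' (q ^ 2) - / 3 * target)).
  { apply is_lim_minus'.
    - apply (airy_integral u u' A A' exp3_0 exp3_1 exp3_2
        (fun x => g0 * u x) (fun x => g0 * u' x)); auto;
        try (intros; apply exp3_cycle).
      + unfold exp3_2. rewrite C0, S0, exp_0. field.
      + intros t Ht. unfold exp3_2. destruct (damped_bounds t Ht) as [B1 B2].
        pose proof (exp_ineq1_le t).
        apply Rabs_le_between in B1. apply Rabs_le_between in B2. apply Rabs_le. nra.
      + now apply (airy_scal_pair u u' A A').
      + unfold exp3_0. rewrite (pair_u0 _ _ _ _ HP), C0, exp_0. fold g0. field.
      + unfold exp3_1. rewrite (pair_u'0 _ _ _ _ HP), C0, S0, exp_0. fold g1. field.
    - apply (is_lim_scal_l _ (/ 3) p_infty target).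
      apply (is_lim_scal_l _ (s * q * E) p_infty (2 * sqrt (PI / 2))).
      replace (2 * sqrt (PI / 2)) with (sqrt (PI / 2) + sqrt (PI / 2)) by ring.
      apply is_lim_plus'; [|apply is_lim_const].
      rewrite <- gaussian_moment.
      apply (is_lim_comp (moment 2 0) (fun N => (N - q) / s) p_infty (full_moment 2 0) p_infty).
      + apply (full_moment_spec 0 0).
      + apply is_lim_spec. intros M. exists (M * s + q). intros x Hx.
        apply Rlt_div_r; [easy | lra].
      + exists 0. easy. }
  assert (Hb : Rabs (g0 * u' (q ^ 2) - / 3 * target) <= g1 + / 3 * (s * q * E * (248 / q))).
  { eapply is_lim_Rabs_le; [exact Hlim|]. exists q. intros N HN.
    assert (Ex : forall t, ex_derive exp3_1 t) by (intros t; eexists; apply exp3_cycle).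
    assert (R1 : Rabs (RInt (fun r => (r * weight 3 r) * (exp3_1 (q ^ 2 * r) - / 3 * exp (q ^ 2 * r))) 0 N) <= 1 * g1).
    { apply (RInt_moment_bound (fun t => exp3_1 t - / 3 * exp t)); [easy | lra | |].
      - intros t. apply (ex_derive_minus exp3_1 (fun t => / 3 * exp t)); [apply Ex|].
        auto_derive. easy.
      - intros t Ht. unfold exp3_1. destruct (damped_bounds t Ht) as [B1 B2].
        apply Rabs_le_between in B1. apply Rabs_le_between in B2. apply Rabs_le. nra. }
    assert (Cd : forall t, ex_derive (fun r => (r * weight 3 r) * exp3_1 (q ^ 2 * r)) t).
    { intros t. apply (ex_derive_mult (fun r => r * weight 3 r) (fun r => exp3_1 (q ^ 2 * r))).
      - unfold weight. auto_derive. easy.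
      - apply (ex_derive_comp exp3_1 (fun r => q ^ 2 * r)); [apply Ex|]. auto_derive. easy. }
    assert (Ce : forall t, ex_derive (fun r => (r * weight 3 r) * exp (q ^ 2 * r)) t).
    { intros t. unfold weight. auto_derive. easy. }
    assert (R2 : RInt (fun r => (r * weight 3 r) * exp3_1 (q ^ 2 * r)) 0 N
       = RInt (fun r => (r * weight 3 r) * (exp3_1 (q ^ 2 * r) - / 3 * exp (q ^ 2 * r))) 0 N
         + / 3 * laplace_integral (q ^ 2) N).
    { unfold laplace_integral. rewrite <- RInt_mult_const, <- RInt_plus_R.
      - apply RInt_ext. intros r _. 
        change (r * weight 3 r * exp3_1 (q ^ 2 * r) = r * weight 3 r * (exp3_1 (q ^ 2 * r) - / 3 * exp (q ^ 2 * r)) + / 3 * (r * weight 3 r * exp (q ^ 2 * r))). ring.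
      - apply ex_RInt_cont. intros t _. apply continuous_ext with
         (f := fun r => (r * weight 3 r) * exp3_1 (q ^ 2 * r) - / 3 * ((r * weight 3 r) * exp (q ^ 2 * r))).
        + intros r. simpl. ring.
        + apply (ex_derive_continuous (V := R_NormedModule)).
          apply (ex_derive_minus (fun r => (r * weight 3 r) * exp3_1 (q ^ 2 * r))
            (fun r => / 3 * ((r * weight 3 r) * exp (q ^ 2 * r)))); [apply Cd|].
          now apply ex_derive_scal.
      - apply ex_RInt_cont. intros t _. apply (ex_derive_continuous (V := R_NormedModule)).
        now apply ex_derive_scal.
      - apply ex_RInt_cont. intros t _. now apply (ex_derive_continuous (V := R_NormedModule)). }
    pose proof (laplace_integral_error q N Hq HN) as R3. fold s E in R3.
    rewrite R2. apply Rabs_le_between in R1. apply Rabs_le_between in R3. apply Rabs_le. lra. }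
  assert (Ht : target = growth q * sqrt PI).
  { unfold target, growth. fold E. 
    replace (s * q * E * (2 * sqrt (PI / 2))) with (s * q * (2 * sqrt (PI / 2)) * E) by ring.
    rewrite Hsp. ring. }
  assert (Hg : s * q * E <= growth q) by (unfold growth; fold E; nra).
  pose proof (growth_ge q Hq) as Hgq.
  assert (E1 : g0 * u' (q ^ 2) - / 3 * target = g0 * (u' (q ^ 2) - growth_amplitude * growth q)).
  { rewrite Ht. unfold growth_amplitude. fold g0. field. lra. }
  rewrite E1, Rabs_mult, (Rabs_pos_eq g0) in Hb by lra.
  apply (Rmult_le_reg_l g0); [easy|]. eapply Rle_trans; [exact Hb|].
  replace (g0 * ((g1 + 248 / 3) / g0 / q * growth q))
    with (g1 * (growth q / q) + / 3 * (growth q * (248 / q))) by (field; lra).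
  assert (1 <= growth q / q) by (apply Rle_div_r; lra).
  assert (0 < 248 / q) by (apply Rdiv_lt_0_compat; lra).
  assert (s * q * E * (248 / q) <= growth q * (248 / q)) by (apply Rmult_le_compat_r; lra).
  nra.
Qed.

(** * Sign and monotonicity of the Airy pair *)

Lemma continuous_continuity (f : R -> R) : (forall x, continuous f x) -> continuity f.
Proof. intros H x. apply continuity_pt_filterlim, H. Qed.

Lemma no_zero_same_sign (f : R -> R) (a b : R) :
  (forall x, continuous f x) -> (forall x, Rmin a b <= x <= Rmax a b -> f x <> 0) ->
  0 < f a -> 0 < f b.
Proof.
  intros Hc H0 Ha. destruct (Rle_dec (f b) 0) as [Hb|]; [exfalso|lra].
  destruct (IVT_gen f a b 0 (continuous_continuity f Hc)) as [x [Hx E]].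
  - rewrite Rmin_right, Rmax_left by lra. lra.
  - now apply (H0 x Hx).
Qed.

Lemma le_div_all_pos (a C q : R) : 0 < q -> (forall p, q <= p -> - (C / p) <= a) -> 0 <= a.
Proof.
  intros Hq H. destruct (Rle_dec 0 a) as [|Hn]; [easy | exfalso].
  assert (HC : 0 < C).
  { specialize (H q ltac:(lra)). assert (0 < C / q) by lra.
    apply (Rmult_lt_reg_r (/ q)); [now apply Rinv_0_lt_compat|]. unfold Rdiv in *. lra. }
  set (p := Rmax q (2 * C / - a)).
  pose proof (Rmax_l q (2 * C / - a)). pose proof (Rmax_r q (2 * C / - a)). fold p in H0, H1.
  specialize (H p H0).
  assert (C / p <= - a / 2); [|lra].
  apply Rle_div_l; [lra|]. apply Rle_div_l in H1; lra.
Qed.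

Lemma pair_u_continuous u u' A A' : airy_pair u u' A A' ->
  (forall x, continuous u x) /\ (forall x, continuous u' x) /\
  (forall x, continuous A x) /\ (forall x, continuous A' x).
Proof.
  intros [Hu HA _ _ _ _].
  repeat split; intros; now (apply (airy_continuous u u') || apply (airy_continuous A A')).
Qed.

(** [u u'] has the nonnegative derivative [u'^2 + x u^2], so [u^2] increases from 1
    and [u] cannot change sign. *)
Lemma pair_u_ge_1 u u' A A' x : airy_pair u u' A A' -> 0 <= x -> 1 <= u x.
Proof.
  intros HP Hx. pose proof (pair_u _ _ _ _ HP) as Hu.
  pose proof (pair_u0 _ _ _ _ HP) as U0. pose proof (pair_u'0 _ _ _ _ HP) as U1.
  assert (H1 : forall t, 0 <= t -> 0 <= u t * u' t).
  { intros t Ht. replace 0 with (u 0 * u' 0) by (rewrite U1; ring).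
    apply (derive_nonneg_le (fun t => u t * u' t) (fun t => u' t * u' t + t * (u t * u t))); [easy| |].
    - intros z _. destruct (Hu z). eapply is_derive_eq.
      + apply (is_derive_mult u u'); eauto. intros; apply Rmult_comm.
      + unfold plus, mult; simpl. ring.
    - intros z Hz. nra. }
  assert (H2 : forall t, 0 <= t -> 1 <= u t * u t).
  { intros t Ht. replace 1 with (u 0 * u 0) by (rewrite U0; ring).
    apply (derive_nonneg_le (fun t => u t * u t) (fun t => 2 * (u t * u' t))); [easy| |].
    - intros z _. destruct (Hu z). eapply is_derive_eq.
      + apply (is_derive_mult u u); eauto. intros; apply Rmult_comm.
      + unfold plus, mult; simpl. ring.
    - intros z Hz. pose proof (H1 z ltac:(lra)). lra. }
  assert (0 < u x).
  { apply (no_zero_same_sign u 0 x); [apply (pair_u_continuous _ _ _ _ HP)| |lra].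
    intros t Ht. rewrite Rmin_left in Ht by easy. specialize (H2 t ltac:(lra)).
    intros E. rewrite E in H2. lra. }
  specialize (H2 x Hx). nra.
Qed.

Lemma pair_u'_ge u u' A A' x : airy_pair u u' A A' -> 0 <= x -> x ^ 2 / 2 <= u' x.
Proof.
  intros HP Hx. pose proof (pair_u _ _ _ _ HP) as Hu.
  pose proof (pair_u'0 _ _ _ _ HP) as U1.
  assert (u' 0 - 0 ^ 2 / 2 <= u' x - x ^ 2 / 2); [|rewrite U1 in H; lra].
  apply (derive_nonneg_le (fun t => u' t - t ^ 2 / 2) (fun t => t * u t - t)); [easy| |].
  - intros t _. apply (is_derive_minus u' (fun t => t ^ 2 / 2)); [apply Hu|].
    auto_derive; [easy|]. field.
  - intros t Ht. pose proof (pair_u_ge_1 _ _ _ _ t HP ltac:(lra)). nra.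
Qed.

(** Only the Wronskian survives in the numerator, so the slope ratio, unlike
    [A'] itself, has a derivative of known sign on each side of the origin. *)
Lemma slope_ratio_derive u u' A A' x : airy_pair u u' A A' -> u' x <> 0 ->
  is_derive (fun t => A' t / u' t) x (x * airy_slope / u' x ^ 2).
Proof.
  intros HP Hx. rewrite <- (pair_wronskian _ _ _ _ x HP).
  destruct HP as [Hu HA _ _ _ _]. destruct (Hu x), (HA x).
  eapply is_derive_eq; [apply is_derive_div; eauto|]. simpl. field. easy.
Qed.

Lemma slope_ratio_bound u u' A A' x : airy_pair u u' A A' -> 0 < x ->
  Rabs (A' x / u' x) <= 4 * airy_slope / x ^ 2.
Proof.
  intros HP Hx. pose proof (pair_A'_bounded _ _ _ _ x HP Hx) as HA.
  pose proof (pair_u'_ge _ _ _ _ x HP ltac:(lra)) as Hu.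
  assert (Hx2 : 0 < x ^ 2) by (apply pow_lt; lra). pose proof airy_slope_pos.
  unfold Rdiv at 1. rewrite Rabs_mult, Rabs_inv, (Rabs_pos_eq (u' x)) by lra.
  apply Rle_div_l; [lra|].
  apply Rle_trans with (4 * airy_slope / x ^ 2 * (x ^ 2 / 2)).
  - replace (4 * airy_slope / x ^ 2 * (x ^ 2 / 2)) with (2 * airy_slope) by (field; lra). easy.
  - apply Rmult_le_compat_l; [|easy]. left. apply Rdiv_lt_0_compat; lra.
Qed.

Lemma slope_ratio_lt u u' A A' x y : airy_pair u u' A A' -> 0 < x -> x < y ->
  A' x / u' x < A' y / u' y.
Proof.
  intros HP Hx Hy.
  assert (Hpos : forall t, 0 < t -> 0 < u' t).
  { intros t Ht. pose proof (pair_u'_ge _ _ _ _ t HP ltac:(lra)).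
    assert (0 < t ^ 2) by (apply pow_lt; lra). lra. }
  apply (derive_pos_lt (fun t => A' t / u' t) (fun t => t * airy_slope / u' t ^ 2)); [easy| |].
  - intros t Ht. apply (slope_ratio_derive u u' A A'); [easy|]. specialize (Hpos t ltac:(lra)). lra.
  - intros t Ht. specialize (Hpos t ltac:(lra)). pose proof airy_slope_pos.
    apply Rdiv_lt_0_compat; [nra | apply pow_lt; easy].
Qed.

Lemma pair_u'_pos u u' A A' x : airy_pair u u' A A' -> 0 < x -> 0 < u' x.
Proof.
  intros HP Hx. pose proof (pair_u'_ge _ _ _ _ x HP ltac:(lra)).
  assert (0 < x ^ 2) by (apply pow_lt; lra). lra.
Qed.

Lemma slope_bound_pow (C p : R) : 0 <= C -> 1 <= p -> C / p ^ 2 <= C / p.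
Proof.
  intros HC Hp. apply Rmult_le_compat_l; [easy|]. apply Rinv_le_contravar; [lra|].
  simpl. nra.
Qed.

(** The slope ratio increases strictly on the half-line and tends to 0. *)
Lemma pair_A'_neg u u' A A' x : airy_pair u u' A A' -> 0 <= x -> A' x < 0.
Proof.
  intros HP Hx. pose proof airy_slope_pos.
  destruct (Req_dec x 0) as [->|Hx0]; [rewrite (pair_A'0 _ _ _ _ HP); lra|].
  assert (Hr : 0 <= - (A' (x + 1) / u' (x + 1))).
  { apply le_div_all_pos with (C := 4 * airy_slope) (q := x + 1); [lra|].
    intros p Hp. pose proof (slope_ratio_bound _ _ _ _ p HP ltac:(lra)) as B.
    apply Rabs_le_between in B.
    pose proof (slope_bound_pow (4 * airy_slope) p ltac:(lra) ltac:(lra)).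
    destruct (Req_dec p (x + 1)) as [<-|]; [lra|].
    pose proof (slope_ratio_lt _ _ _ _ (x + 1) p HP ltac:(lra) ltac:(lra)). lra. }
  pose proof (slope_ratio_lt _ _ _ _ x (x + 1) HP ltac:(lra) ltac:(lra)) as L.
  pose proof (pair_u'_pos _ _ _ _ x HP ltac:(lra)) as Hu.
  assert (A' x / u' x < 0) by lra.
  apply Rlt_div_l in H0; lra.
Qed.

(** The same argument for [A / u], which decreases; it tends to 0 because it
    equals [A' / u' + airy_slope / (u u')]. *)
Lemma pair_A_pos u u' A A' x : airy_pair u u' A A' -> 0 <= x -> 0 < A x.
Proof.
  intros HP Hx. pose proof airy_slope_pos as HW.
  assert (D : forall y z, 0 <= y -> y < z -> A z / u z < A y / u y).
  { intros y z Hy Hz.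
    assert (- (A y / u y) < - (A z / u z)); [|lra].
    apply (derive_pos_lt (fun t => - (A t / u t)) (fun t => airy_slope / u t ^ 2)); [easy| |].
    - intros t Ht. pose proof (pair_u_ge_1 _ _ _ _ t HP ltac:(lra)).
      rewrite <- (pair_wronskian _ _ _ _ t HP).
      destruct HP as [Hu HA _ _ _ _]. destruct (Hu t), (HA t).
      eapply is_derive_eq.
      + apply (is_derive_opp (fun t => A t / u t)). apply is_derive_div; eauto. lra.
      + unfold opp; simpl. field. lra.
    - intros t Ht. pose proof (pair_u_ge_1 _ _ _ _ t HP ltac:(lra)).
      apply Rdiv_lt_0_compat; [easy | apply pow_lt; lra]. }
  assert (Hr : 0 <= A (x + 1) / u (x + 1)).
  { apply le_div_all_pos with (C := 4 * airy_slope) (q := x + 1); [lra|].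
    intros p Hp. pose proof (slope_ratio_bound _ _ _ _ p HP ltac:(lra)) as B.
    apply Rabs_le_between in B.
    pose proof (slope_bound_pow (4 * airy_slope) p ltac:(lra) ltac:(lra)).
    pose proof (pair_u'_pos _ _ _ _ p HP ltac:(lra)) as Hu.
    pose proof (pair_u_ge_1 _ _ _ _ p HP ltac:(lra)) as Hu1.
    assert (E : A p / u p = A' p / u' p + airy_slope / (u p * u' p)).
    { rewrite <- (pair_wronskian _ _ _ _ p HP). field. lra. }
    assert (0 < airy_slope / (u p * u' p)) by (apply Rdiv_lt_0_compat; nra).
    destruct (Req_dec p (x + 1)) as [<-|]; [lra|].
    specialize (D (x + 1) p ltac:(lra) ltac:(lra)). lra. }
  specialize (D x (x + 1) Hx ltac:(lra)).
  pose proof (pair_u_ge_1 _ _ _ _ x HP ltac:(lra)) as Hu1.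
  assert (0 < A x / u x) by lra.
  apply Rlt_div_r in H; lra.
Qed.

Lemma largest_zero_pos u u' A A' a : airy_pair u u' A A' -> is_largest_zero A' (- a) -> 0 < a.
Proof.
  intros HP [Hz _]. destruct (Rlt_dec 0 a) as [|Hn]; [easy|].
  pose proof (pair_A'_neg _ _ _ _ (- a) HP ltac:(lra)). lra.
Qed.

Lemma pair_A'_neg_left u u' A A' a x : airy_pair u u' A A' -> is_largest_zero A' (- a) ->
  - a < x -> A' x < 0.
Proof.
  intros HP [Hz Hl] Hx.
  destruct (Rle_dec 0 x) as [H0|H0]; [now apply (pair_A'_neg u u' A A')|].
  assert (0 < - A' x); [|lra].
  apply (no_zero_same_sign (fun t => - A' t) 0 x).
  - intros t. apply (continuous_opp (V := R_NormedModule)), (pair_u_continuous _ _ _ _ HP).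
  - intros t Ht E. rewrite Rmin_right in Ht by lra.
    specialize (Hl t ltac:(lra)). lra.
  - pose proof (pair_A'_neg _ _ _ _ 0 HP ltac:(lra)). lra.
Qed.

Lemma pair_A_ge_1_left u u' A A' a x : airy_pair u u' A A' -> is_largest_zero A' (- a) ->
  - a <= x <= 0 -> 1 <= A x.
Proof.
  intros HP Hz Hx. rewrite <- (pair_A0 _ _ _ _ HP).
  assert (- A x <= - A 0); [|lra].
  apply (derive_nonneg_le (fun t => - A t) (fun t => - A' t)); [lra| |].
  - intros t _. apply (is_derive_opp A). apply (pair_A _ _ _ _ HP).
  - intros t Ht. pose proof (pair_A'_neg_left _ _ _ _ a t HP Hz ltac:(lra)). lra.
Qed.

Lemma pair_A_pos_left u u' A A' a x : airy_pair u u' A A' -> is_largest_zero A' (- a) ->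
  - a <= x -> 0 < A x.
Proof.
  intros HP Hz Hx. destruct (Rle_dec 0 x); [now apply (pair_A_pos u u' A A')|].
  pose proof (pair_A_ge_1_left _ _ _ _ a x HP Hz). lra.
Qed.

(** At [- a] the Wronskian is [A u']; to the right of it [u' / A'] increases to its
    value 0 at the origin, while [A'] is negative. *)
Lemma pair_u'_pos_left u u' A A' a x : airy_pair u u' A A' -> is_largest_zero A' (- a) ->
  - a <= x < 0 -> 0 < u' x.
Proof.
  intros HP Hz Hx. pose proof airy_slope_pos as HW.
  destruct (Req_dec x (- a)) as [->|Hne].
  - pose proof (pair_wronskian _ _ _ _ (- a) HP) as E.
    rewrite (proj1 Hz) in E. pose proof (pair_A_pos_left _ _ _ _ a (- a) HP Hz ltac:(lra)). nra.
  - assert (Hneg : forall t, - a < t -> A' t < 0)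
      by (intros t Ht; now apply (pair_A'_neg_left u u' A A' a)).
    assert (L : u' x / A' x < u' 0 / A' 0).
    { apply (derive_pos_lt (fun t => u' t / A' t) (fun t => - t * airy_slope / A' t ^ 2)); [lra| |].
      - intros t Ht. specialize (Hneg t ltac:(lra)).
        rewrite <- (pair_wronskian _ _ _ _ t HP).
        destruct HP as [Hu HA _ _ _ _]. destruct (Hu t), (HA t).
        eapply is_derive_eq; [apply is_derive_div; eauto; lra|]. simpl. field. lra.
      - intros t Ht. specialize (Hneg t ltac:(lra)).
        apply Rdiv_lt_0_compat; [nra|]. replace (A' t ^ 2) with ((- A' t) ^ 2) by ring.
        apply pow_lt. lra. }
    rewrite (pair_u'0 _ _ _ _ HP) in L. specialize (Hneg x ltac:(lra)).
    unfold Rdiv in L. rewrite Rmult_0_l in L.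
    assert (/ A' x < 0) by now apply Rinv_lt_0_compat. nra.
Qed.

(** * Neumann and Dirichlet conditions on an interval *)

(** Vanishes exactly when some nonzero Airy solution is flat at [X] and [X + c]. *)
Definition neumann_gap (u' A' : R -> R) (c X : R) : R :=
  A' X * u' (X + c) - u' X * A' (X + c).

Lemma neumann_gap_nonneg_start u u' A A' c X : airy_pair u u' A A' -> 0 < c -> 0 <= X ->
  neumann_gap u' A' c X < 0.
Proof.
  intros HP Hc HX. unfold neumann_gap.
  pose proof (pair_u'_pos _ _ _ _ (X + c) HP ltac:(lra)) as HZ.
  destruct (Req_dec X 0) as [->|].
  - rewrite (pair_u'0 _ _ _ _ HP), (pair_A'0 _ _ _ _ HP). pose proof airy_slope_pos. nra.
  - pose proof (pair_u'_pos _ _ _ _ X HP ltac:(lra)) as HX'.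
    pose proof (slope_ratio_lt _ _ _ _ X (X + c) HP ltac:(lra) ltac:(lra)) as L.
    replace (A' X * u' (X + c) - u' X * A' (X + c)) with
      (u' X * u' (X + c) * (A' X / u' X - A' (X + c) / u' (X + c))) by (field; lra).
    assert (0 < u' X * u' (X + c)) by nra. nra.
Qed.

Lemma dirichlet_ratio_lt u u' A A' a x y : airy_pair u u' A A' -> is_largest_zero A' (- a) ->
  - a <= x -> x < y -> u x / A x < u y / A y.
Proof.
  intros HP Hz Hx Hy.
  apply (derive_pos_lt (fun t => u t / A t) (fun t => airy_slope / A t ^ 2)); [easy| |].
  - intros t Ht. pose proof (pair_A_pos_left _ _ _ _ a t HP Hz ltac:(lra)).
    rewrite <- (pair_wronskian _ _ _ _ t HP).
    destruct HP as [Hu HA _ _ _ _]. destruct (Hu t), (HA t).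
    eapply is_derive_eq; [apply is_derive_div; eauto; lra|]. simpl. field. lra.
  - intros t Ht. pose proof (pair_A_pos_left _ _ _ _ a t HP Hz ltac:(lra)).
    apply Rdiv_lt_0_compat; [apply airy_slope_pos | apply pow_lt; easy].
Qed.

Lemma dirichlet_excluded u u' A A' a c X : airy_pair u u' A A' -> is_largest_zero A' (- a) ->
  0 < c -> - a <= X -> A X * u (X + c) <> u X * A (X + c).
Proof.
  intros HP Hz Hc HX E.
  pose proof (dirichlet_ratio_lt _ _ _ _ a X (X + c) HP Hz HX ltac:(lra)) as L.
  pose proof (pair_A_pos_left _ _ _ _ a X HP Hz HX).
  pose proof (pair_A_pos_left _ _ _ _ a (X + c) HP Hz ltac:(lra)).
  assert (u X / A X = u (X + c) / A (X + c)); [|lra].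
  replace (u (X + c)) with (A X * u (X + c) / A X) by (field; lra). rewrite E. field. lra.
Qed.

Lemma neumann_zero_between u u' A A' c X0 : airy_pair u u' A A' -> 0 < c -> X0 < 0 ->
  0 < neumann_gap u' A' c X0 ->
  exists X, X0 < X < 0 /\ neumann_gap u' A' c X = 0.
Proof.
  intros HP Hc HX0 H0.
  pose proof (neumann_gap_nonneg_start _ _ _ _ c 0 HP Hc ltac:(lra)) as H1.
  destruct (pair_u_continuous _ _ _ _ HP) as [_ [Cu [_ CA]]].
  destruct (IVT_gen (neumann_gap u' A' c) X0 0 0) as [X [HX E]].
  - apply continuous_continuity. intros x. unfold neumann_gap.
    assert (S : forall g : R -> R, (forall t, continuous g t) -> continuous (fun t => g (t + c)) x).
    { intros g Hg. apply (continuous_comp (fun t => t + c) g); [|apply Hg].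
      apply (continuous_plus (V := R_NormedModule) (fun t => t) (fun _ => c));
        [apply continuous_id | apply continuous_const]. }
    apply (continuous_minus (V := R_NormedModule) (fun X => A' X * u' (X + c)) (fun X => u' X * A' (X + c)));
      apply (continuous_mult (K := R_AbsRing)); auto.
  - rewrite Rmin_right, Rmax_left by lra. lra.
  - rewrite Rmin_left, Rmax_right in HX by lra. exists X. split; [|easy].
    split.
    + destruct (Req_dec X X0) as [->|]; lra.
    + destruct (Req_dec X 0) as [->|]; lra.
Qed.

Lemma neumann_gap_at_zero u u' A A' a c : airy_pair u u' A A' -> is_largest_zero A' (- a) ->
  0 < c -> 0 < neumann_gap u' A' c (- a).
Proof.
  intros HP Hz Hc. unfold neumann_gap. rewrite (proj1 Hz).
  pose proof (largest_zero_pos _ _ _ _ a HP Hz).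
  pose proof (pair_u'_pos_left _ _ _ _ a (- a) HP Hz ltac:(lra)).
  pose proof (pair_A'_neg_left _ _ _ _ a (- a + c) HP Hz ltac:(lra)). nra.
Qed.

(** On the symmetric interval the constant is a trial function with vanishing
    mean potential.  In Riccati form: for the positive solution [w] that is flat
    at the left end, [p = w' / w] satisfies [p' = x - p ^ 2], and the integral
    of [x] cancels. *)
Lemma neumann_gap_symmetric u u' A A' a b : airy_pair u u' A A' -> is_largest_zero A' (- a) ->
  0 < b < a -> 0 < neumann_gap u' A' (2 * b) (- b).
Proof.
  intros HP Hz Hb. pose proof airy_slope_pos as HW.
  set (w := fun y => u' (- b) * A y + - A' (- b) * u y).
  set (w' := fun y => u' (- b) * A' y + - A' (- b) * u' y).
  pose proof (pair_u'_pos_left _ _ _ _ a (- b) HP Hz ltac:(lra)) as Hu.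
  pose proof (pair_A'_neg_left _ _ _ _ a (- b) HP Hz ltac:(lra)) as HA.
  assert (Hwd : airy w w').
  { apply airy_combination; [apply (pair_A _ _ _ _ HP) | apply (pair_u _ _ _ _ HP)]. }
  assert (Hw : forall y, - b <= y -> 0 < w y).
  { intros y Hy.
    pose proof (pair_A_pos_left _ _ _ _ a (- b) HP Hz ltac:(lra)) as A0.
    pose proof (pair_A_pos_left _ _ _ _ a y HP Hz ltac:(lra)) as A1.
    assert (L : u (- b) / A (- b) <= u y / A y).
    { destruct (Req_dec y (- b)) as [->|]; [lra|].
      left. apply (dirichlet_ratio_lt u u' A A' a); auto; lra. }
    assert (Ew : w y = A y * (u' (- b) + (u y / A y) * - A' (- b))) by (unfold w; field; lra).
    rewrite Ew. apply Rmult_lt_0_compat; [easy|].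
    apply Rlt_le_trans with (u' (- b) + u (- b) / A (- b) * - A' (- b)).
    - replace (u' (- b) + u (- b) / A (- b) * - A' (- b)) with (airy_slope / A (- b)).
      + now apply Rdiv_lt_0_compat.
      + rewrite <- (pair_wronskian _ _ _ _ (- b) HP). field. lra.
    - apply Rplus_le_compat_l, Rmult_le_compat_r; lra. }
  set (g := fun y => (y ^ 2 - b ^ 2) / 2 - w' y / w y).
  assert (Hg : forall y, - b <= y -> is_derive g y ((w' y / w y) ^ 2)).
  { intros y Hy. destruct (Hwd y). specialize (Hw y Hy).
    eapply is_derive_eq.
    - apply (is_derive_minus (fun y => (y ^ 2 - b ^ 2) / 2) (fun y => w' y / w y)).
      + auto_derive; [easy|]. reflexivity.
      + apply is_derive_div; eauto. lra.
    - unfold minus, plus, opp; simpl. field. lra. }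
  assert (W0 : w' (- b) = 0) by (unfold w'; ring).
  assert (G0 : g (- b) = 0).
  { unfold g. rewrite W0. unfold Rdiv. ring. }
  assert (Wneg : forall y, - b < y <= 0 -> w' y < 0).
  { intros y Hy. assert (- w' (- b) < - w' y); [|lra].
    apply (derive_pos_lt (fun t => - w' t) (fun t => - (t * w t))); [lra| |].
    - intros t _. apply (is_derive_opp w'). apply Hwd.
    - intros t Ht. specialize (Hw t ltac:(lra)). nra. }
  assert (G1 : g (- b) < g 0).
  { apply (derive_pos_lt g (fun y => (w' y / w y) ^ 2)); [lra| |].
    - intros y Hy. apply Hg. lra.
    - intros y Hy. specialize (Hw y ltac:(lra)). specialize (Wneg y ltac:(lra)).
      replace ((w' y / w y) ^ 2) with ((- w' y / w y) ^ 2) by (field; lra).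
      apply pow_lt. apply Rdiv_lt_0_compat; lra. }
  assert (G2 : g 0 <= g b).
  { apply (derive_nonneg_le g (fun y => (w' y / w y) ^ 2)); [lra| |].
    - intros y Hy. apply Hg. lra.
    - intros y Hy. apply pow2_ge_0. }
  assert (G3 : g b = - (w' b / w b)) by (unfold g; field; specialize (Hw b ltac:(lra)); lra).
  specialize (Hw b ltac:(lra)).
  assert (0 < - w' b / w b) by (unfold Rdiv in *; lra).
  apply Rlt_div_r in H; [|easy].
  unfold neumann_gap. replace (- b + 2 * b) with b by ring. unfold w' in H. lra.
Qed.

(** * The slope ratio at infinity *)

Lemma inv_square_error r : Rabs r <= 1 / 2 -> Rabs (/ (1 + r) ^ 2 - 1) <= 10 * Rabs r.
Proof.
  intros Hr. pose proof (Rabs_pos r). pose proof Hr as Hr'. apply Rabs_le_between in Hr'.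
  replace (/ (1 + r) ^ 2 - 1) with (r * (- (2 + r) * / (1 + r) ^ 2)) by (field; lra).
  rewrite Rabs_mult, (Rmult_comm 10). apply Rmult_le_compat_l; [easy|].
  rewrite Rabs_mult, Rabs_Ropp, Rabs_inv, (Rabs_pos_eq (2 + r)), (Rabs_pos_eq (_ ^ 2))
    by (try apply pow2_ge_0; lra).
  assert (1 / 4 <= (1 + r) ^ 2) by (simpl; nra).
  apply Rle_div_l; nra.
Qed.

(** The source of the constant [sqrt 3]: here [PI] cancels between the Gaussian
    integral in [growth_amplitude] and the reflection formula. *)
Lemma amplitude_identity : airy_slope / growth_amplitude ^ 2 = 2 * sqrt 3.
Proof.
  destruct full_moment_pos as [G0 G1]. pose proof cubic_moments_product as E.
  destruct sqrt3_spec as [S3 S3b]. pose proof PI_RGT_0.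
  assert (SP : sqrt PI * sqrt PI = PI) by (apply sqrt_sqrt; lra).
  assert (0 < sqrt PI) by now apply sqrt_lt_R0.
  unfold airy_slope, growth_amplitude.
  set (g0 := full_moment 3 0) in *. set (g1 := full_moment 3 1) in *.
  transitivity (9 * (g0 * g1) / (sqrt PI * sqrt PI)); [field; lra|].
  rewrite SP, E. transitivity (2 * 3 / sqrt 3); [field; lra|].
  transitivity (2 * (sqrt 3 * sqrt 3) / sqrt 3); [now rewrite S3 | field; lra].
Qed.

(** By [pair_u'_asymptotics] and [amplitude_identity] the derivative of the slope
    ratio along [x = p ^ 2] is that of [- sqrt 3 * exp (- 4/3 * p^3)] up to a
    relative error at most [k] for all [p >= q].  So adding [1 + k], respectively
    [1 - k], times that exponential makes the ratio monotone on [[q, oo)], with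
    limit 0, hence of known sign at [q]. *)
Lemma slope_ratio_asymptotics u u' A A' : airy_pair u u' A A' ->
  exists K q0, 0 < K /\ 1 <= q0 /\ forall q, q0 <= q ->
    Rabs (A' (q ^ 2) / u' (q ^ 2) + sqrt 3 * exp (- (4 / 3 * q ^ 3)))
    <= K / q * (sqrt 3 * exp (- (4 / 3 * q ^ 3))).
Proof.
  intros HP. destruct (pair_u'_asymptotics _ _ _ _ HP) as [K [HK HKq]].
  pose proof growth_amplitude_pos as Hl. pose proof airy_slope_pos as HW.
  destruct sqrt3_spec as [S3 S3b].
  set (l := growth_amplitude) in *.
  set (K1 := K / l). assert (HK1 : 0 < K1) by (apply Rdiv_lt_0_compat; easy).
  exists (10 * K1), (Rmax 1 (2 * K1)). split; [lra|]. split; [apply Rmax_l|].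
  intros q Hq. pose proof (Rmax_l 1 (2 * K1)). pose proof (Rmax_r 1 (2 * K1)).
  set (e := fun p => sqrt 3 * exp (- (4 / 3 * p ^ 3))).
  set (y := fun p => A' (p ^ 2) / u' (p ^ 2)).
  change (Rabs (y q + e q) <= 10 * K1 / q * e q).
  set (k := 10 * K1 / q).
  assert (He : forall p, is_derive e p (- (4 * p ^ 2) * e p)).
  { intros p. unfold e. auto_derive; [easy|].
    simpl. unfold Rdiv. field. }
  assert (Hep : forall p, 0 < e p) by (intros; apply Rmult_lt_0_compat; [lra | apply exp_pos]).
  assert (Hy : forall p, 0 < p -> is_derive y p (2 * p ^ 3 * airy_slope / u' (p ^ 2) ^ 2)).
  { intros p Hp. assert (0 < p ^ 2) by (apply pow_lt; lra).
    pose proof (pair_u'_pos _ _ _ _ (p ^ 2) HP H1).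
    eapply is_derive_eq.
    - apply (is_derive_comp (fun x => A' x / u' x) (fun p => p ^ 2)).
      + apply (slope_ratio_derive u u' A A'); [exact HP | lra].
      + instantiate (1 := 2 * p). auto_derive; [easy|]. ring.
    - change (2 * p * (p ^ 2 * airy_slope / u' (p ^ 2) ^ 2)
        = 2 * p ^ 3 * airy_slope / u' (p ^ 2) ^ 2). field. lra. }
  assert (Hrate : forall p, q <= p ->
    Rabs (2 * p ^ 3 * airy_slope / u' (p ^ 2) ^ 2 - 4 * p ^ 2 * e p) <= k * (4 * p ^ 2 * e p)).
  { intros p Hp. assert (Hp1 : 1 <= p) by lra.
    specialize (HKq p Hp1).
    set (g := growth p) in *.
    assert (Hg : 0 < g) by (pose proof (growth_ge p Hp1); unfold g; lra).
    set (r := (u' (p ^ 2) - l * g) / (l * g)).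
    assert (Hlg : 0 < l * g) by now apply Rmult_lt_0_compat.
    assert (Hr : Rabs r <= K1 / p).
    { unfold r, Rdiv at 1. rewrite Rabs_mult, Rabs_inv, (Rabs_pos_eq (l * g)) by lra.
      apply Rle_div_l; [easy|]. eapply Rle_trans; [exact HKq|].
      right. unfold K1. field. lra. }
    assert (Hr2 : K1 / p <= 1 / 2) by (apply Rle_div_l; lra).
    assert (Eu : u' (p ^ 2) = l * g * (1 + r)) by (unfold r; field; lra).
    assert (Eg : g ^ 2 = p * exp (4 / 3 * p ^ 3)).
    { unfold g, growth. replace (4 / 3 * p ^ 3) with (2 / 3 * p ^ 3 + 2 / 3 * p ^ 3) by field.
      rewrite exp_plus. rewrite <- (sqrt_sqrt p) at 3 by lra. ring. }
    assert (Hr' := Hr). apply Rabs_le_between in Hr'.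
    assert (E1 : 2 * p ^ 3 * airy_slope / u' (p ^ 2) ^ 2 = 4 * p ^ 2 * e p * / (1 + r) ^ 2).
    { rewrite Eu. unfold e. rewrite exp_Ropp.
      assert (Es : airy_slope = 2 * sqrt 3 * l ^ 2).
      { rewrite <- amplitude_identity. fold l. field. lra. }
      rewrite Es. replace ((l * g * (1 + r)) ^ 2) with (l ^ 2 * g ^ 2 * (1 + r) ^ 2) by ring.
      rewrite Eg. pose proof (exp_pos (4 / 3 * p ^ 3)). field. lra. }
    rewrite E1.
    assert (Hc : 0 < 4 * p ^ 2 * e p).
    { apply Rmult_lt_0_compat; [|apply Hep]. assert (0 < p ^ 2) by (apply pow_lt; lra). lra. }
    replace (4 * p ^ 2 * e p * / (1 + r) ^ 2 - 4 * p ^ 2 * e p)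
      with (4 * p ^ 2 * e p * (/ (1 + r) ^ 2 - 1)) by ring.
    rewrite Rabs_mult, (Rabs_pos_eq (4 * p ^ 2 * e p)), Rmult_comm by lra.
    apply Rmult_le_compat_r; [lra|].
    eapply Rle_trans; [apply inv_square_error; lra|].
    apply Rle_trans with (10 * (K1 / p)); [lra|]. unfold k.
    replace (10 * K1 / q) with (10 * (K1 / q)) by (field; lra).
    apply Rmult_le_compat_l; [lra|]. apply Rmult_le_compat_l; [lra|].
    apply Rinv_le_contravar; lra. }
  assert (Htail : forall p, q <= p -> Rabs (y p) <= 4 * airy_slope / p /\ e p <= 2 / p).
  { intros p Hp. split.
    - unfold y. assert (0 < p ^ 2) by (apply pow_lt; lra).
      eapply Rle_trans; [apply (slope_ratio_bound u u' A A'); auto|].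
      eapply Rle_trans; [apply slope_bound_pow; [lra|]|].
      + simpl. nra.
      + apply slope_bound_pow; lra.
    - unfold e. rewrite exp_Ropp.
      assert (p <= exp (4 / 3 * p ^ 3)).
      { eapply Rle_trans; [|apply exp_ineq1_le].
        assert (p * 1 <= p * (p * p)) by (apply Rmult_le_compat_l; nra). simpl. nra. }
      apply Rmult_le_compat; [lra | left; apply Rinv_0_lt_compat, exp_pos | lra |].
      apply Rinv_le_contravar; lra. }
  assert (Hk : 0 < k) by (apply Rdiv_lt_0_compat; lra).
  assert (Hup : 0 <= y q + (1 + k) * e q).
  { apply le_div_all_pos with (C := 4 * airy_slope) (q := q); [lra|].
    intros p Hp. destruct (Htail p Hp) as [T1 T2]. apply Rabs_le_between in T1.
    assert (- (y q + (1 + k) * e q) <= - (y p + (1 + k) * e p)).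
    { apply (derive_nonneg_le (fun t => - (y t + (1 + k) * e t))
        (fun t => - (2 * t ^ 3 * airy_slope / u' (t ^ 2) ^ 2 + (1 + k) * (- (4 * t ^ 2) * e t)))); [easy| |].
      - intros t Ht. apply (is_derive_opp (fun t => y t + (1 + k) * e t)).
        apply (is_derive_plus y (fun t => (1 + k) * e t)); [apply Hy; lra|].
        apply is_derive_scal, He.
      - intros t Ht. specialize (Hrate t ltac:(lra)). apply Rabs_le_between in Hrate. lra. }
    specialize (Hep p). nra. }
  assert (Hlo : 0 <= - (y q + (1 - k) * e q)).
  { apply le_div_all_pos with (C := 4 * airy_slope + 2) (q := q); [lra|].
    intros p Hp. destruct (Htail p Hp) as [T1 T2]. apply Rabs_le_between in T1.
    assert (y q + (1 - k) * e q <= y p + (1 - k) * e p).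
    { apply (derive_nonneg_le (fun t => y t + (1 - k) * e t)
        (fun t => 2 * t ^ 3 * airy_slope / u' (t ^ 2) ^ 2 + (1 - k) * (- (4 * t ^ 2) * e t))); [easy| |].
      - intros t Ht.
        apply (is_derive_plus y (fun t => (1 - k) * e t)); [apply Hy; lra|].
        apply is_derive_scal, He.
      - intros t Ht. specialize (Hrate t ltac:(lra)). apply Rabs_le_between in Hrate. lra. }
    specialize (Hep p).
    replace ((4 * airy_slope + 2) / p) with (4 * airy_slope / p + 2 / p) by (field; lra).
    nra. }
  apply Rabs_le. specialize (Hep q). split; nra.
Qed.

(** * From the periodic problem to Neumann and Dirichlet conditions *)

Lemma is_derive_linear {V W : NormedModule R_AbsRing} (l : V -> W) (f : R -> V) (x : R) (d : V) :
  is_linear l -> is_derive f x d -> is_derive (fun t => l (f t)) x (l d).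
Proof.
  intros Hl Hf.
  apply filterdiff_ext_lin with (l1 := fun y : R => l (scal y d)).
  - apply (filterdiff_comp' f l x (fun y : R => scal y d) l Hf).
    now apply filterdiff_linear.
  - intros y. apply (linear_scal (K := R_AbsRing) l Hl).
Qed.

Lemma is_derive_Re (f : R -> C) x d : is_derive f x d -> is_derive (fun t => fst (f t)) x (fst d).
Proof.
  apply (is_derive_linear (V := prod_NormedModule R_AbsRing R_NormedModule R_NormedModule)
    (W := R_NormedModule) (fun t => fst t)). apply is_linear_fst.
Qed.

Lemma is_derive_Im (f : R -> C) x d : is_derive f x d -> is_derive (fun t => snd (f t)) x (snd d).
Proof.
  apply (is_derive_linear (V := prod_NormedModule R_AbsRing R_NormedModule R_NormedModule)
    (W := R_NormedModule) (fun t => snd t)). apply is_linear_snd.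
Qed.

Lemma is_derive_RtoC (f : R -> R) x d :
  is_derive f x d -> is_derive (fun t => RtoC (f t)) x (RtoC d).
Proof.
  apply (is_derive_linear (V := R_NormedModule)
    (W := prod_NormedModule R_AbsRing R_NormedModule R_NormedModule) (fun t => (t, 0))).
  apply (is_linear_prod (K := R_AbsRing) (T := R_NormedModule) (U := R_NormedModule) (V := R_NormedModule)
    (fun t => t) (fun _ => 0));
    [apply is_linear_id | apply (is_linear_zero (K := R_AbsRing) (U := R_NormedModule) (V := R_NormedModule))].
Qed.

(** The rescaled Airy function [z (X + k x)] solves the same equation as [g], so
    their Wronskian is constant. *)
Lemma scaled_wronskian (g g' z z' : R -> R) (k X L : R) :
  0 <= L -> airy z z' ->
  (forall x, 0 <= x <= L ->
     is_derive g x (g' x) /\ is_derive g' x (k ^ 2 * (X + k * x) * g x)) ->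
  g L * (k * z' (X + k * L)) - g' L * z (X + k * L) = g 0 * (k * z' X) - g' 0 * z X.
Proof.
  intros HL Hz Hg.
  assert (Hlin : forall x, is_derive (fun x => X + k * x) x k)
    by (intros; auto_derive; [easy | ring]).
  pose proof (derive_zero_eq (wronskian g g' (fun x => z (X + k * x)) (fun x => k * z' (X + k * x)))
    0 L HL) as E.
  unfold wronskian in E at 2 3. rewrite Rmult_0_r, Rplus_0_r in E.
  symmetry. apply E. intros x Hx. destruct (Hg x Hx). destruct (Hz (X + k * x)).
  eapply is_derive_eq.
  - apply wronskian_derive; eauto.
    + apply (is_derive_comp z (fun x => X + k * x)); auto.
    + apply is_derive_scal. apply (is_derive_comp z' (fun x => X + k * x)); eauto.
  - unfold scal; simpl; unfold mult; simpl. ring.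
Qed.

(** Splitting into even and odd parts reduces the periodic problem for an even
    potential to Neumann, respectively Dirichlet, conditions on half a period. *)
Lemma periodic_dichotomy u u' A A' (f f' : R -> R) (k X L : R) :
  airy_pair u u' A A' -> 0 < k -> 0 < L ->
  (forall x, - L <= x <= L ->
     is_derive f x (f' x) /\ is_derive f' x (k ^ 2 * (X + k * Rabs x) * f x)) ->
  f (- L) = f L -> f' (- L) = f' L ->
  neumann_gap u' A' (k * L) X = 0 \/
  A X * u (X + k * L) = u X * A (X + k * L) \/
  (forall x, - L <= x <= L -> f x = 0).
Proof.
  intros HP Hk HL Hf B0 B1. pose proof airy_slope_pos as HW.
  set (sym := fun s x => f x + s * f (- x)).
  set (sym' := fun s x => f' x - s * f' (- x)).
  assert (Hd : forall s x, 0 <= x <= L ->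
    is_derive (sym s) x (sym' s x) /\
    is_derive (sym' s) x (k ^ 2 * (X + k * x) * sym s x)).
  { intros s x Hx. destruct (Hf x ltac:(lra)) as [F1 F2].
    destruct (Hf (- x) ltac:(lra)) as [F3 F4]. rewrite Rabs_Ropp in F4.
    rewrite Rabs_pos_eq in F2, F4 by lra.
    assert (Hopp : is_derive Ropp x (-1)) by (auto_derive; [easy | ring]).
    unfold sym, sym'. split.
    - eapply is_derive_eq.
      + apply (is_derive_plus f (fun x => s * f (- x))); [eauto|].
        apply is_derive_scal. apply (is_derive_comp f Ropp); eauto.
      + unfold plus, scal; simpl; unfold mult; simpl. ring.
    - eapply is_derive_eq.
      + apply (is_derive_minus f' (fun x => s * f' (- x))); [eauto|].
        apply is_derive_scal. apply (is_derive_comp f' Ropp); eauto.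
      + unfold minus, plus, opp, scal; simpl; unfold mult; simpl. ring. }
  assert (Hzero : forall s, sym s 0 = 0 -> sym' s 0 = 0 -> forall x, 0 <= x <= L -> sym s x = 0).
  { intros s S0 S1 x Hx.
    assert (Hdx : forall t, 0 <= t <= x -> is_derive (sym s) t (sym' s t) /\
      is_derive (sym' s) t (k ^ 2 * (X + k * t) * sym s t)) by (intros; apply Hd; lra).
    pose proof (scaled_wronskian (sym s) (sym' s) u u' k X x ltac:(lra) (pair_u _ _ _ _ HP) Hdx) as E1.
    pose proof (scaled_wronskian (sym s) (sym' s) A A' k X x ltac:(lra) (pair_A _ _ _ _ HP) Hdx) as E2.
    rewrite S0, S1 in E1, E2.
    pose proof (pair_wronskian _ _ _ _ (X + k * x) HP) as W.
    assert (E : sym s x * (k * airy_slope) = 0).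
    { rewrite <- W.
      replace (sym s x * (k * (A (X + k * x) * u' (X + k * x) - A' (X + k * x) * u (X + k * x))))
        with (A (X + k * x) * (sym s x * (k * u' (X + k * x)) - sym' s x * u (X + k * x))
          - u (X + k * x) * (sym s x * (k * A' (X + k * x)) - sym' s x * A (X + k * x))) by ring.
      rewrite E1, E2. ring. }
    apply Rmult_integral in E. destruct E; [easy | nra]. }
  assert (Heven : forall z z', airy z z' -> sym 1 L * (k * z' (X + k * L)) = sym 1 0 * (k * z' X)).
  { intros z z' Hz.
    pose proof (scaled_wronskian (sym 1) (sym' 1) z z' k X L ltac:(lra) Hz (Hd 1)) as E.
    replace (sym' 1 0) with 0 in E by (unfold sym'; rewrite Ropp_0; ring).
    replace (sym' 1 L) with 0 in E by (unfold sym'; rewrite B1; ring). lra. }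
  assert (Hodd : forall z z', airy z z' -> sym' (-1) L * z (X + k * L) = sym' (-1) 0 * z X).
  { intros z z' Hz.
    pose proof (scaled_wronskian (sym (-1)) (sym' (-1)) z z' k X L ltac:(lra) Hz (Hd (-1))) as E.
    replace (sym (-1) 0) with 0 in E by (unfold sym; rewrite Ropp_0; ring).
    replace (sym (-1) L) with 0 in E by (unfold sym; rewrite B0; ring). lra. }
  pose proof (Heven _ _ (pair_u _ _ _ _ HP)) as Eu. pose proof (Heven _ _ (pair_A _ _ _ _ HP)) as EA.
  pose proof (Hodd _ _ (pair_u _ _ _ _ HP)) as Ou. pose proof (Hodd _ _ (pair_A _ _ _ _ HP)) as OA.
  destruct (Req_dec (sym 1 0) 0) as [S0|S0].
  2:{ left. unfold neumann_gap. apply (Rmult_eq_reg_l (sym 1 0 * k)); [|nra].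
      replace (sym 1 0 * k * (A' X * u' (X + k * L) - u' X * A' (X + k * L)))
        with (u' (X + k * L) * (sym 1 0 * (k * A' X)) - A' (X + k * L) * (sym 1 0 * (k * u' X))) by ring.
      rewrite <- Eu, <- EA. ring. }
  destruct (Req_dec (sym' (-1) 0) 0) as [S1|S1].
  2:{ right; left. apply (Rmult_eq_reg_l (sym' (-1) 0)); [|easy].
      rewrite <- !Rmult_assoc, <- Ou, <- OA. ring. }
  right; right.
  assert (Z1 : forall x, 0 <= x <= L -> sym 1 x = 0).
  { apply Hzero; [easy|]. unfold sym'. rewrite Ropp_0. ring. }
  assert (Z2 : forall x, 0 <= x <= L -> sym (-1) x = 0).
  { apply Hzero; [|easy]. unfold sym. rewrite Ropp_0. ring. }
  unfold sym in Z1, Z2. intros x Hx.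
  destruct (Rle_dec 0 x) as [H0|H0].
  - specialize (Z1 x ltac:(lra)). specialize (Z2 x ltac:(lra)). lra.
  - specialize (Z1 (- x) ltac:(lra)). specialize (Z2 (- x) ltac:(lra)).
    rewrite Ropp_involutive in Z1, Z2. lra.
Qed.

(** Even and odd extensions are glued at the origin rather than written with
    [Rabs], so that one differentiation rule serves both. *)
Definition glue (h1 h2 : R -> R) (x : R) : R := if Rle_dec 0 x then h1 x else h2 x.

Lemma is_derive_glue (h1 h2 d1 d2 : R -> R) (x : R) :
  (forall t, is_derive h1 t (d1 t)) -> (forall t, is_derive h2 t (d2 t)) ->
  h1 0 = h2 0 -> d1 0 = d2 0 -> is_derive (glue h1 h2) x (glue d1 d2 x).
Proof.
  intros H1 H2 E0 E1.
  destruct (Rtotal_order x 0) as [Hx|[->|Hx]].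
  - apply is_derive_ext_loc with (f := h2).
    + exists (mkposreal (- x) ltac:(lra)). intros t Ht. apply Rabs_def2 in Ht.
      unfold minus, plus, opp in Ht; simpl in Ht. unfold glue. destruct (Rle_dec 0 t); [lra | easy].
    + unfold glue. destruct (Rle_dec 0 x); [lra | apply H2].
  - replace (glue d1 d2 0) with (d1 0) by (unfold glue; destruct (Rle_dec 0 0); [easy | lra]).
    apply is_derive_Reals. intros eps Heps.
    destruct (proj1 (is_derive_Reals h1 0 (d1 0)) (H1 0) eps Heps) as [[e1 P1] D1].
    destruct (proj1 (is_derive_Reals h2 0 (d2 0)) (H2 0) eps Heps) as [[e2 P2] D2].
    exists (mkposreal (Rmin e1 e2) (Rmin_glb_lt _ _ _ P1 P2)). simpl in *.
    intros h Hh Hb. pose proof (Rmin_l e1 e2). pose proof (Rmin_r e1 e2).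
    rewrite Rplus_0_l.
    replace (glue h1 h2 0) with (h1 0) by (unfold glue; destruct (Rle_dec 0 0); [easy | lra]).
    unfold glue. destruct (Rle_dec 0 h).
    + specialize (D1 h Hh ltac:(lra)). now rewrite Rplus_0_l in D1.
    + specialize (D2 h Hh ltac:(lra)). rewrite Rplus_0_l in D2. now rewrite E0, E1.
  - apply is_derive_ext_loc with (f := h1).
    + exists (mkposreal x ltac:(lra)). intros t Ht. apply Rabs_def2 in Ht.
      unfold minus, plus, opp in Ht; simpl in Ht. unfold glue. destruct (Rle_dec 0 t); [easy | lra].
    + unfold glue. destruct (Rle_dec 0 x); [apply H1 | lra].
Qed.

(** The even extension is differentiable at 0 because the Neumann solution is flat
    there, and its derivative matches at the end points because it is flat at [L]. *)
Lemma neumann_periodic u u' A A' (k X L : R) :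
  airy_pair u u' A A' -> 0 < k -> 0 < L -> neumann_gap u' A' (k * L) X = 0 ->
  exists f f' : R -> R,
    (forall x, is_derive f x (f' x) /\ is_derive f' x (k ^ 2 * (X + k * Rabs x) * f x)) /\
    f (- L) = f L /\ f' (- L) = f' L /\ f 0 <> 0.
Proof.
  intros HP Hk HL HN. unfold neumann_gap in HN. pose proof airy_slope_pos as HW.
  set (w := fun y => u' X * A y + - A' X * u y).
  set (w' := fun y => u' X * A' y + - A' X * u' y).
  assert (Hw : airy w w').
  { apply airy_combination; [apply (pair_A _ _ _ _ HP) | apply (pair_u _ _ _ _ HP)]. }
  assert (W0 : w' X = 0) by (unfold w'; ring).
  assert (W1 : w' (X + k * L) = 0) by (unfold w'; lra).
  assert (W2 : w X = airy_slope) by (rewrite <- (pair_wronskian _ _ _ _ X HP); unfold w; ring).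
  set (g := fun x => w (X + k * x)). set (g' := fun x => k * w' (X + k * x)).
  assert (Hlin : forall x, is_derive (fun x => X + k * x) x k)
    by (intros; auto_derive; [easy | ring]).
  assert (Hopp : forall x, is_derive Ropp x (-1)) by (intros; auto_derive; [easy | ring]).
  assert (Hg : forall x, is_derive g x (g' x)).
  { intros x. apply (is_derive_comp w (fun x => X + k * x)); [apply Hw | apply Hlin]. }
  assert (Hg' : forall x, is_derive g' x (k ^ 2 * (X + k * x) * g x)).
  { intros x. eapply is_derive_eq.
    - apply is_derive_scal. apply (is_derive_comp w' (fun x => X + k * x)); [apply Hw | apply Hlin].
    - unfold g, scal; simpl; unfold mult; simpl. ring. }
  assert (G0 : g' 0 = 0).
  { unfold g'. replace (X + k * 0) with X by ring. rewrite W0. ring. }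
  assert (G1 : g' L = 0) by (unfold g'; rewrite W1; ring).
  exists (glue g (fun x => g (- x))), (glue g' (fun x => - g' (- x))).
  split; [|split; [|split]].
  - intros x. split.
    + apply is_derive_glue; auto.
      * intros t. eapply is_derive_eq; [apply (is_derive_comp g Ropp); eauto|].
        unfold scal; simpl; unfold mult; simpl. ring.
      * now rewrite Ropp_0.
      * rewrite Ropp_0. lra.
    + eapply is_derive_eq.
      * apply (is_derive_glue g' (fun x => - g' (- x)) (fun x => k ^ 2 * (X + k * x) * g x)
          (fun x => k ^ 2 * (X + k * - x) * g (- x))); auto.
        -- intros t. eapply is_derive_eq.
           { apply (is_derive_opp (fun x => g' (- x))). apply (is_derive_comp g' Ropp); eauto. }
           unfold opp, scal; simpl; unfold mult; simpl. ring.
        -- rewrite Ropp_0. lra.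
        -- now rewrite Ropp_0.
      * unfold glue. destruct (Rle_dec 0 x).
        -- now rewrite Rabs_pos_eq by lra.
        -- now rewrite Rabs_left by lra.
  - unfold glue. destruct (Rle_dec 0 (- L)); [lra|]. destruct (Rle_dec 0 L); [|lra].
    now rewrite Ropp_involutive.
  - unfold glue. destruct (Rle_dec 0 (- L)); [lra|]. destruct (Rle_dec 0 L); [|lra].
    rewrite Ropp_involutive. lra.
  - unfold glue. destruct (Rle_dec 0 0); [|lra]. unfold g.
    replace (X + k * 0) with X by ring. lra.
Qed.

(** * Scaling *)

Lemma potential_cell L0 V0 x : 0 < L0 -> - L0 <= x <= L0 ->
  potential L0 V0 x = V0 * (Rabs x / L0 - 1).
Proof.
  intros HL Hx. unfold potential.
  set (n := Int_part ((x + L0) / (2 * L0))).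
  destruct (base_Int_part ((x + L0) / (2 * L0))) as [B1 B2]. fold n in B1, B2.
  assert (Hr : 0 <= (x + L0) / (2 * L0) <= 1).
  { split; [apply Rdiv_le_0_compat; lra | apply Rle_div_l; lra]. }
  assert (E : n = 0%Z \/ n = 1%Z).
  { assert (-1 < IZR n) by lra. assert (IZR n <= 1) by lra.
    apply (lt_IZR (-1)) in H. apply (le_IZR _ 1) in H0. lia. }
  destruct E as [E|E]; rewrite E in *.
  - rewrite Rmult_0_r, Rminus_0_r. easy.
  - (* the right end point, where the count of periods has just jumped *)
    assert (x = L0).
    { assert (1 <= (x + L0) / (2 * L0)) by lra. apply Rle_div_r in H; lra. }
    subst x. replace (L0 - 2 * L0 * 1) with (- L0) by ring. now rewrite Rabs_Ropp.
Qed.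

Lemma theta_pos hbar m L0 V0 : 0 < theta hbar m L0 V0.
Proof. apply exp_pos. Qed.

Lemma theta_cube hbar m L0 V0 : 0 < hbar -> 0 < m -> 0 < L0 -> 0 < V0 ->
  theta hbar m L0 V0 ^ 3 = 2 * m * L0 ^ 2 / (hbar ^ 2 * V0 ^ 2).
Proof.
  intros Hh Hm HL HV. unfold theta.
  rewrite <- Rpower_pow by apply Rpower_pos. rewrite Rpower_mult.
  replace (1 / 3 * INR 3) with 1 by (simpl; field). apply Rpower_1.
  apply Rdiv_lt_0_compat; repeat apply Rmult_lt_0_compat; try apply pow_lt; lra.
Qed.

(** The choice of [theta] is what makes [hbar^2 / (2 m) * (c / L0)^2 = 1 / theta]. *)
Lemma schrodinger_scaled hbar m L0 V0 E y dd x :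
  0 < hbar -> 0 < m -> 0 < L0 -> 0 < V0 -> - L0 <= x <= L0 ->
  (- (hbar ^ 2 / (2 * m)) * dd + potential L0 V0 x * y = E * y <->
   dd = (cpar hbar m L0 V0 / L0) ^ 2 *
     (- cpar hbar m L0 V0 - theta hbar m L0 V0 * E + cpar hbar m L0 V0 / L0 * Rabs x) * y).
Proof.
  intros Hh Hm HL HV Hx. rewrite potential_cell by easy.
  pose proof (theta_cube hbar m L0 V0 Hh Hm HL HV) as T3. pose proof (theta_pos hbar m L0 V0) as T.
  unfold cpar. set (t := theta hbar m L0 V0) in *.
  assert (Hk : hbar ^ 2 / (2 * m) * (t * V0 / L0) ^ 2 = / t).
  { transitivity (hbar ^ 2 / (2 * m) * V0 ^ 2 / L0 ^ 2 * t ^ 3 * / t); [field; lra|].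
    rewrite T3. field. lra. }
  assert (Ha : 0 < hbar ^ 2 / (2 * m)) by (apply Rdiv_lt_0_compat; [apply pow_lt|]; lra).
  set (a := hbar ^ 2 / (2 * m)) in *.
  set (r := (t * V0 / L0) ^ 2 * (- (t * V0) - t * E + t * V0 / L0 * Rabs x) * y).
  assert (Er : a * r = V0 * (Rabs x / L0 - 1) * y - E * y).
  { unfold r. rewrite <- !Rmult_assoc, Hk. field. lra. }
  split; intros H.
  - apply (Rmult_eq_reg_l a); lra.
  - rewrite H. lra.
Qed.

Lemma eigenvalue_conditions u u' A A' hbar m L0 V0 E (c := cpar hbar m L0 V0)
  (X := - c - theta hbar m L0 V0 * E) :
  airy_pair u u' A A' -> 0 < hbar -> 0 < m -> 0 < L0 -> 0 < V0 ->
  periodic_eigenvalue hbar m L0 V0 E ->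
  neumann_gap u' A' c X = 0 \/ A X * u (X + c) = u X * A (X + c).
Proof.
  intros HP Hh Hm HL HV [psi [dpsi [ddpsi [Hode [B0 [B1 [x0 [Hx0 Hne]]]]]]]].
  assert (Hc : 0 < c) by (apply Rmult_lt_0_compat; [apply theta_pos | easy]).
  assert (Hk : 0 < c / L0) by now apply Rdiv_lt_0_compat.
  assert (EkL : c / L0 * L0 = c) by (field; lra).
  assert (Hpart : forall p : C -> R, (p = fst \/ p = snd) ->
     neumann_gap u' A' c X = 0 \/ A X * u (X + c) = u X * A (X + c) \/
     (forall x, - L0 <= x <= L0 -> p (psi x) = 0)).
  { intros p Hp. rewrite <- EkL.
    apply (periodic_dichotomy u u' A A' (fun x => p (psi x)) (fun x => p (dpsi x))); auto.
    - intros x Hx. destruct (Hode x Hx) as [D1 [D2 Heq]].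
      assert (Hdd : p (ddpsi x) = (c / L0) ^ 2 * (X + c / L0 * Rabs x) * p (psi x)).
      { apply (schrodinger_scaled hbar m L0 V0 E); auto.
        destruct Hp as [-> | ->].
        - apply (f_equal fst) in Heq. simpl in Heq. simpl. lra.
        - apply (f_equal snd) in Heq. simpl in Heq. simpl. lra. }
      rewrite <- Hdd. destruct Hp as [-> | ->].
      + split; [now apply is_derive_Re | now apply is_derive_Re].
      + split; [now apply is_derive_Im | now apply is_derive_Im].
    - now rewrite B0.
    - now rewrite B1. }
  destruct (Hpart fst (or_introl eq_refl)) as [H|[H|Hre]]; auto.
  destruct (Hpart snd (or_intror eq_refl)) as [H|[H|Him]]; auto.
  exfalso. apply Hne. specialize (Hre x0 Hx0). specialize (Him x0 Hx0).
  destruct (psi x0) as [a b]. simpl in *. now rewrite Hre, Him.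
Qed.

Lemma neumann_eigenvalue u u' A A' hbar m L0 V0 X (c := cpar hbar m L0 V0) :
  airy_pair u u' A A' -> 0 < hbar -> 0 < m -> 0 < L0 -> 0 < V0 ->
  neumann_gap u' A' c X = 0 ->
  periodic_eigenvalue hbar m L0 V0 ((- c - X) / theta hbar m L0 V0).
Proof.
  intros HP Hh Hm HL HV HN. pose proof (theta_pos hbar m L0 V0) as T.
  assert (Hc : 0 < c) by (apply Rmult_lt_0_compat; [apply theta_pos | easy]).
  assert (Hk : 0 < c / L0) by now apply Rdiv_lt_0_compat.
  assert (EkL : c / L0 * L0 = c) by (field; lra).
  rewrite <- EkL in HN.
  destruct (neumann_periodic u u' A A' (c / L0) X L0 HP Hk HL HN) as [f [f' [Hf [B0 [B1 F0]]]]].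
  exists (fun x => RtoC (f x)), (fun x => RtoC (f' x)),
    (fun x => RtoC ((c / L0) ^ 2 * (X + c / L0 * Rabs x) * f x)).
  split; [|split; [|split]].
  - intros x Hx. destruct (Hf x) as [F1 F2]. split; [|split].
    + now apply is_derive_RtoC.
    + now apply is_derive_RtoC.
    + rewrite <- !RtoC_mult, <- RtoC_plus. f_equal.
      apply schrodinger_scaled; auto. fold c.
      replace (- c - theta hbar m L0 V0 * ((- c - X) / theta hbar m L0 V0)) with X; [easy|].
      field. lra.
  - now rewrite B0.
  - now rewrite B1.
  - exists 0. split; [lra|]. intros H. apply F0. now apply RtoC_inj.
Qed.

(** * The lowest eigenvalue *)

(** To the right of a negative point where [neumann_gap] is positive there is a zero
    of [neumann_gap], which yields an eigenvalue; as larger [X] means smaller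
    energy, minimality of [E] puts [X] to the right of that point too.  Being to the
    right of [- a] then excludes the Dirichlet alternative. *)
Lemma ground_state_location u u' A A' a hbar m L0 V0 E (c := cpar hbar m L0 V0)
  (X := - c - theta hbar m L0 V0 * E) :
  airy_pair u u' A A' -> is_largest_zero A' (- a) ->
  0 < hbar -> 0 < m -> 0 < L0 -> 0 < V0 -> is_Emin0 hbar m L0 V0 E ->
  - a < X /\ - c / 2 < X /\ X < 0 /\ neumann_gap u' A' c X = 0.
Proof.
  intros HP Hz Hh Hm HL HV [Heig Hmin].
  pose proof (theta_pos hbar m L0 V0) as T.
  assert (Hc : 0 < c) by (apply Rmult_lt_0_compat; [apply theta_pos | easy]).
  pose proof (largest_zero_pos u u' A A' a HP Hz) as Ha.
  assert (Hbelow : forall X0, X0 < 0 -> 0 < neumann_gap u' A' c X0 -> X0 < X).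
  { intros X0 H0 HX0.
    destruct (neumann_zero_between u u' A A' c X0 HP Hc H0 HX0) as [X1 [HX1 E1]].
    specialize (Hmin _ (neumann_eigenvalue u u' A A' hbar m L0 V0 X1 HP Hh Hm HL HV E1)).
    apply Rle_div_r in Hmin; [|easy]. unfold X. fold c in Hmin. lra. }
  assert (H1 : - a < X) by (apply Hbelow; [lra | now apply (neumann_gap_at_zero u u' A A')]).
  assert (H2 : - c / 2 < X).
  { destruct (Rlt_dec (c / 2) a) as [Hca|Hca]; [|lra].
    apply Hbelow; [lra|].
    pose proof (neumann_gap_symmetric u u' A A' a (c / 2) HP Hz ltac:(lra)) as G.
    replace (2 * (c / 2)) with c in G by field.
    replace (- c / 2) with (- (c / 2)) by field. exact G. }
  assert (H3 : neumann_gap u' A' c X = 0).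
  { destruct (eigenvalue_conditions u u' A A' hbar m L0 V0 E HP Hh Hm HL HV Heig) as [H|H]; [easy|].
    exfalso. now apply (dirichlet_excluded u u' A A' a c X HP Hz Hc ltac:(lra)). }
  split; [easy | split; [easy | split; [|easy]]].
  destruct (Rlt_dec X 0); [easy | exfalso].
  pose proof (neumann_gap_nonneg_start u u' A A' c X HP Hc ltac:(lra)). lra.
Qed.

(** * Asymptotics of the splitting *)

Definition one_plus_O (s k x : R) : Prop := Rabs (x - 1) <= k * s.

Lemma one_plus_O_mult s k1 k2 x y : 0 <= s <= 1 ->
  one_plus_O s k1 x -> one_plus_O s k2 y -> one_plus_O s (k1 + k2 + k1 * k2) (x * y).
Proof.
  unfold one_plus_O. intros Hs Hx Hy.
  replace (x * y - 1) with ((x - 1) + (y - 1) + (x - 1) * (y - 1)) by ring.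
  eapply Rle_trans; [apply Rabs_triang|].
  eapply Rle_trans; [apply Rplus_le_compat_r, Rabs_triang|].
  rewrite Rabs_mult. pose proof (Rabs_pos (x - 1)). pose proof (Rabs_pos (y - 1)).
  assert (Rabs (x - 1) * Rabs (y - 1) <= (k1 * s) * (k2 * s)) by (apply Rmult_le_compat; easy).
  assert ((k1 * s) * (k2 * s) <= k1 * k2 * s).
  { replace ((k1 * s) * (k2 * s)) with (k1 * s * k2 * s) by ring.
    destruct (Req_dec s 0) as [->|]; [lra|].
    assert (0 <= k1) by nra. assert (0 <= k2) by nra. 
    assert (0 <= k1 * k2 * s) by (apply Rmult_le_pos; [apply Rmult_le_pos|]; lra). nra. }
  lra.
Qed.

Lemma one_plus_O_exp s k x : 0 <= s <= 1 -> Rabs x <= k * s -> one_plus_O s (k * exp k) (exp x).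
Proof.
  intros Hs Hx. unfold one_plus_O. pose proof (Rabs_pos x).
  destruct (Req_dec s 0) as [->|Hs0].
  - assert (x = 0) as ->. { apply Rabs_eq_0. lra. }
    rewrite exp_0, Rminus_diag, Rabs_R0. lra.
  - assert (Hk : 0 <= k) by nra.
    eapply Rle_trans.
    + apply (exp_minus_1_bound x k); [|easy].
      pose proof (Rle_abs x). nra.
    + rewrite (Rmult_comm k), Rmult_assoc, Rmult_comm.
      apply Rmult_le_compat_l; [left; apply exp_pos | easy].
Qed.

(** With [b = a - d = p^2 - q^2], the difference [p^3 - q^3] equals
    [3/2 b p - b^2 (2q + p) / (2 (p + q)^2)] exactly. *)
Lemma phase_expansion p q a d D : 1 <= p -> 0 < q -> q ^ 2 = p ^ 2 - a + d ->
  0 <= d <= a -> d <= D / p ^ 2 ->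
  Rabs (- (4 / 3 * q ^ 3) - (- (4 / 3 * p ^ 3) + 2 * a * p)) <= (2 * D + 4 / 3 * a ^ 2) * / p.
Proof.
  intros Hp Hq E Hd HD.
  set (b := a - d). assert (Eb : p ^ 2 - q ^ 2 = b) by (unfold b; lra).
  assert (E1 : - (4 / 3 * q ^ 3) - (- (4 / 3 * p ^ 3) + 2 * a * p)
     = - (2 * (d * p) + 2 / 3 * b ^ 2 * ((2 * q + p) / (p + q) ^ 2))).
  { rewrite <- Eb. replace a with (p ^ 2 - q ^ 2 + d) by lra. field. lra. }
  rewrite E1, Rabs_Ropp, Rabs_pos_eq.
  2:{ apply Rplus_le_le_0_compat; [nra|]. apply Rmult_le_pos; [pose proof (pow2_ge_0 b); lra|].
      apply Rdiv_le_0_compat; [lra | apply pow_lt; lra]. }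
  assert (Hip : 0 < / p) by (apply Rinv_0_lt_compat; lra).
  assert (B1 : d * p <= D * / p).
  { replace (D * / p) with (D / p ^ 2 * p) by (field; lra). apply Rmult_le_compat_r; lra. }
  assert (B2 : (2 * q + p) / (p + q) ^ 2 <= 2 * / p).
  { apply Rle_div_l; [apply pow_lt; lra|].
    apply Rle_trans with (2 * (p + q)); [lra|].
    replace (2 * (p + q)) with (2 * / p * (p * (p + q))) by (field; lra).
    apply Rmult_le_compat_l; [lra|]. nra. }
  assert (B3 : b ^ 2 <= a ^ 2) by (apply pow_incr; unfold b; lra).
  pose proof (pow2_ge_0 b).
  assert (B4 : b ^ 2 * ((2 * q + p) / (p + q) ^ 2) <= a ^ 2 * (2 * / p)).
  { apply Rmult_le_compat; try easy.
    apply Rdiv_le_0_compat; [lra | apply pow_lt; lra]. }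
  lra.
Qed.

(** By the mean value theorem for the slope ratio on [[- a, X]], where it starts
    from 0, the splitting is [X + a = - R (X + c) * M z / airy_slope] with
    [M z = u' z ^ 2 / - z] and [z] between [- a] and [X].  A crude bound on [M] shows
    that the splitting is [O(1 / p^2)]; then [M z] may be replaced by [M (- a)] and
    the phase expanded, each at the cost of a factor [1 + O(1 / p)]. *)
Lemma splitting_asymptotics u u' A A' a (kappa := sqrt 3 * (u' (- a)) ^ 2 / (airy_slope * a)) :
  airy_pair u u' A A' -> is_largest_zero A' (- a) ->
  exists K, forall p X, 0 < p -> - a < X < 0 -> neumann_gap u' A' (p ^ 2) X = 0 ->
    Rabs ((X + a) / (kappa * exp (- (4 / 3 * p ^ 3) + 2 * a * p)) - 1) <= K * / p.
Proof.
  intros HP Hz.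
  pose proof (largest_zero_pos u u' A A' a HP Hz) as Ha.
  pose proof airy_slope_pos as HW. destruct sqrt3_spec as [S3 S3b].
  destruct (pair_u_continuous _ _ _ _ HP) as [Cu [Cu' _]].
  destruct (slope_ratio_asymptotics u u' A A' HP) as [K2 [q0 [HK2 [Hq0 Hasym]]]].
  set (M := fun z => u' z ^ 2 / - z).
  assert (HMa : 0 < M (- a)).
  { unfold M. pose proof (pair_u'_pos_left u u' A A' a (- a) HP Hz ltac:(lra)).
    apply Rdiv_lt_0_compat; [apply pow_lt|]; lra. }
  assert (Hkap : kappa = sqrt 3 * M (- a) / airy_slope).
  { unfold kappa, M. rewrite Ropp_involutive. field. lra. }
  assert (Hkpos : 0 < kappa).
  { rewrite Hkap. apply Rdiv_lt_0_compat; [apply Rmult_lt_0_compat|]; lra. }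
  clearbody kappa.
  (* the singularity of M at 0 is removable, because u' vanishes there *)
  assert (HMb : exists Mmax, 0 < Mmax /\ forall z, - a <= z < 0 -> 0 <= M z <= Mmax).
  { destruct (continuous_bounded u (- a) 0) as [B [HB HBu]]; [auto|].
    exists ((a * B) ^ 2 * a).
    split; [apply Rmult_lt_0_compat; [apply pow_lt; nra | easy]|].
    intros z Hzr.
    destruct (mean_value u' (fun t => t * u t) z 0) as [t [Ht E]]; [lra| |].
    { intros t _. apply (pair_u _ _ _ _ HP). }
    rewrite (pair_u'0 _ _ _ _ HP) in E.
    assert (Hab : Rabs (u' z) <= a * B * - z).
    { replace (u' z) with (- (t * u t * (0 - z))) by lra.
      rewrite Rabs_Ropp, !Rabs_mult, (Rabs_left t), (Rabs_pos_eq (0 - z)) by lra.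
      specialize (HBu t ltac:(lra)). pose proof (Rabs_pos (u t)).
      replace (0 - z) with (- z) by ring. apply Rmult_le_compat_r; [lra|].
      apply Rmult_le_compat; lra. }
    assert (Hsq : u' z ^ 2 <= (a * B * - z) ^ 2).
    { rewrite <- (pow2_abs (u' z)). apply pow_incr. split; [apply Rabs_pos | easy]. }
    unfold M. split.
    - apply Rdiv_le_0_compat; [apply pow2_ge_0 | lra].
    - apply Rle_div_l; [lra|]. eapply Rle_trans; [exact Hsq|].
      replace ((a * B * - z) ^ 2) with ((a * B) ^ 2 * - z * - z) by ring.
      apply Rmult_le_compat_r; [lra|]. apply Rmult_le_compat_l; [apply pow2_ge_0 | lra]. }
  destruct HMb as [Mmax [HMmax HMb]].
  assert (HMlip : exists Lip, 0 < Lip /\ forall z, - a < z <= - (a / 2) ->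
     Rabs (M z - M (- a)) <= Lip * (z + a)).
  { set (M' := fun z => - (2 * u z * u' z) + (u' z / z) ^ 2).
    assert (DM : forall z, z < 0 -> is_derive M z (M' z)).
    { intros z Hz0. pose proof (pair_u _ _ _ _ HP z) as [D1 D2].
      unfold M. eapply is_derive_eq.
      - apply (is_derive_div (fun z => u' z ^ 2) Ropp).
        + apply is_derive_pow. exact D2.
        + instantiate (1 := -1). auto_derive; [easy | ring].
        + lra.
      - unfold M'. simpl. field. lra. }
    destruct (continuous_bounded M' (- a) (- (a / 2))) as [B [HB HBM]].
    { intros z Hzr. unfold M'.
      apply (continuous_plus (V := R_NormedModule) (fun z => - (2 * u z * u' z)) (fun z => (u' z / z) ^ 2)).
      - apply (ex_derive_continuous (V := R_NormedModule)).
        apply (ex_derive_opp (fun z => 2 * u z * u' z)).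
        apply (ex_derive_mult (fun z => 2 * u z) u').
        + apply (ex_derive_scal u). eexists; apply (pair_u _ _ _ _ HP z).
        + eexists; apply (pair_u _ _ _ _ HP z).
      - apply (ex_derive_continuous (V := R_NormedModule)).
        apply ex_derive_pow. apply ex_derive_div.
        + eexists; apply (pair_u _ _ _ _ HP z).
        + apply ex_derive_id.
        + lra. }
    exists B. split; [easy|]. intros z Hzr.
    destruct (mean_value M M' (- a) z) as [t [Ht E]]; [lra | |].
    { intros t Ht. apply DM. lra. }
    rewrite E, Rabs_mult, (Rabs_pos_eq (z - - a)) by lra.
    replace (z - - a) with (z + a) by ring.
    apply Rmult_le_compat_r; [lra|]. apply HBM. lra. }
  destruct HMlip as [Lip [HLip HMlip]].
  set (D := 4 * sqrt 3 * (1 + K2) * Mmax / airy_slope).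
  assert (HD : 0 < D).
  { apply Rdiv_lt_0_compat; [|easy]. repeat apply Rmult_lt_0_compat; lra. }
  (* beyond p0 the point q = sqrt (X + p^2) is at least p / 2 and q0, and d <= a / 2 *)
  set (p0 := 1 + 2 * q0 + 2 * a + 2 * D / a).
  assert (HDa : 0 < 2 * D / a) by (apply Rdiv_lt_0_compat; lra).
  assert (Hlarge : exists K, 0 < K /\ forall p X, p0 <= p -> - a < X < 0 ->
    neumann_gap u' A' (p ^ 2) X = 0 ->
    Rabs ((X + a) / (kappa * exp (- (4 / 3 * p ^ 3) + 2 * a * p)) - 1) <= K * / p).
  { set (H := 2 * D + 4 / 3 * a ^ 2).
    set (c1 := 2 * K2). set (c2 := Lip * D / M (- a)). set (c3 := H * exp H).
    assert (Hc1 : 0 < c1) by (unfold c1; lra).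
    assert (Hc2 : 0 < c2) by (apply Rdiv_lt_0_compat; nra).
    assert (Hc3 : 0 < c3).
    { apply Rmult_lt_0_compat; [|apply exp_pos]. unfold H. pose proof (pow2_ge_0 a). lra. }
    exists ((c1 + c2 + c1 * c2) + c3 + (c1 + c2 + c1 * c2) * c3).
    split; [assert (0 < c1 * c2) by nra; nra|].
    intros p X Hp HX HN.
    assert (Hp1 : 1 <= p) by (unfold p0 in Hp; lra).
    set (Z := X + p ^ 2). set (q := sqrt Z). set (d := X + a).
    assert (HpZ : p ^ 2 / 4 <= Z) by (unfold Z, p0 in *; nra).
    assert (Hp2 : 0 < p ^ 2) by (apply pow_lt; lra).
    assert (Eq2 : q ^ 2 = Z) by (unfold q; simpl; rewrite Rmult_1_r; apply sqrt_sqrt; lra).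
    assert (Hqpos : 0 < q) by (apply sqrt_lt_R0; lra).
    assert (Hqp : p / 2 <= q) by (rewrite <- Eq2 in HpZ; nra).
    assert (Hqq : q0 <= q) by (unfold p0 in Hp; lra).
    specialize (Hasym q Hqq). rewrite Eq2 in Hasym.
    set (e := exp (- (4 / 3 * q ^ 3))) in *.
    assert (He : 0 < e) by apply exp_pos.
    assert (HuZ : 0 < u' Z) by (apply (pair_u'_pos u u' A A'); [easy | lra]).
    assert (HuX : forall t, - a <= t <= X -> 0 < u' t)
      by (intros; apply (pair_u'_pos_left u u' A A' a); [easy | easy | lra]).
    assert (ER : A' X / u' X = A' Z / u' Z).
    { specialize (HuX X ltac:(lra)). unfold neumann_gap in HN. fold Z in HN.
      apply (Rmult_eq_reg_l (u' X * u' Z)); [|nra].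
      replace (u' X * u' Z * (A' X / u' X)) with (A' X * u' Z) by (field; lra).
      replace (u' X * u' Z * (A' Z / u' Z)) with (u' X * A' Z) by (field; lra). lra. }
    destruct (mean_value (fun t => A' t / u' t) (fun t => t * airy_slope / u' t ^ 2) (- a) X)
      as [z [Hzr EM]]; [lra| |].
    { intros t Ht. apply (slope_ratio_derive u u' A A'); [easy|].
      specialize (HuX t ltac:(lra)). lra. }
    rewrite (proj1 Hz) in EM. unfold Rdiv at 2 in EM. rewrite Rmult_0_l, Rminus_0_r, ER in EM.
    specialize (HuX z ltac:(lra)).
    set (r1 := - (A' Z / u' Z) / (sqrt 3 * e)).
    assert (Hse : 0 < sqrt 3 * e) by (apply Rmult_lt_0_compat; lra).
    assert (Hip : 0 < / p) by (apply Rinv_0_lt_compat; lra).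
    assert (Hip1 : / p <= 1) by (rewrite <- Rinv_1; apply Rinv_le_contravar; lra).
    assert (Hr1' : Rabs (r1 - 1) <= K2 / q).
    { replace (r1 - 1) with (- (A' Z / u' Z + sqrt 3 * e) / (sqrt 3 * e)) by (unfold r1; field; lra).
      unfold Rdiv at 1. rewrite Rabs_mult, Rabs_Ropp, Rabs_inv, (Rabs_pos_eq (sqrt 3 * e)) by lra.
      apply Rle_div_l; [easy|]. exact Hasym. }
    assert (Hr1 : one_plus_O (/ p) c1 r1).
    { unfold one_plus_O. eapply Rle_trans; [exact Hr1'|]. apply Rle_div_l; [easy|].
      unfold c1. replace K2 with (2 * K2 * / p * (p / 2)) at 1 by (field; lra).
      apply Rmult_le_compat_l; [nra | easy]. }
    assert (Ed : d = sqrt 3 * e * r1 * M z / airy_slope).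
    { unfold d, r1, M. replace (X + a) with (X - - a) by ring.
      rewrite EM. field. repeat split; lra. }
    assert (Hr1b : 0 <= r1 <= 1 + K2).
    { assert (HKq : K2 / q <= K2) by (apply Rle_div_l; nra).
      apply Rabs_le_between in Hr1'. split; [|lra].
      unfold r1. apply Rdiv_le_0_compat; [|easy].
      rewrite EM. 
      assert (z * airy_slope / u' z ^ 2 * (X - - a) <= 0); [|lra].
      assert (0 < - z * airy_slope / u' z ^ 2).
      { apply Rdiv_lt_0_compat; [nra | apply pow_lt; easy]. }
      unfold Rdiv in *. nra. }
    assert (HdD : d <= D / p ^ 2).
    { rewrite Ed. destruct (HMb z ltac:(lra)) as [M0 M1].
      assert (He2 : e <= 4 / p ^ 2).
      { unfold e. rewrite exp_Ropp. replace (4 / p ^ 2) with (/ (p ^ 2 / 4)) by (field; lra).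
        apply Rinv_le_contravar; [lra|].
        eapply Rle_trans; [|apply exp_ineq1_le].
        assert (q ^ 2 * 1 <= q ^ 2 * q) by (apply Rmult_le_compat_l; [apply pow2_ge_0 | lra]).
        replace (q ^ 3) with (q ^ 2 * q) by ring. rewrite <- Eq2 in HpZ.
        pose proof (pow2_ge_0 q). lra. }
      unfold D. apply Rle_div_l; [easy|].
      replace (4 * sqrt 3 * (1 + K2) * Mmax / airy_slope / p ^ 2 * airy_slope)
        with (sqrt 3 * (4 / p ^ 2) * (1 + K2) * Mmax) by (field; lra).
      apply Rmult_le_compat; [|lra| |lra].
      - apply Rmult_le_pos; lra.
      - apply Rmult_le_compat; [lra | lra | | lra]. apply Rmult_le_compat_l; lra. }
    assert (Hd : 0 < d <= a) by (unfold d; lra).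
    assert (Hda : d <= a / 2).
    { eapply Rle_trans; [exact HdD|]. apply Rle_div_l; [easy|].
      assert (HDp : 2 * D / a <= p ^ 2).
      { apply Rle_trans with p; [unfold p0 in Hp; lra | simpl; nra]. }
      apply -> Rle_div_l in HDp; [|easy]. lra. }
    assert (HDp : D / p ^ 2 <= D * / p).
    { unfold Rdiv. apply Rmult_le_compat_l; [lra|]. apply Rinv_le_contravar; [lra | simpl; nra]. }
    assert (Hr2 : one_plus_O (/ p) c2 (M z / M (- a))).
    { unfold one_plus_O. replace (M z / M (- a) - 1) with ((M z - M (- a)) / M (- a)) by (field; lra).
      unfold Rdiv at 1. rewrite Rabs_mult, Rabs_inv, (Rabs_pos_eq (M (- a))) by lra.
      apply Rle_div_l; [easy|]. unfold c2.
      replace (Lip * D / M (- a) * / p * M (- a)) with (Lip * (D * / p)) by (field; lra).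
      eapply Rle_trans; [apply HMlip; unfold d in *; lra|].
      apply Rmult_le_compat_l; unfold d in *; lra. }
    set (eta := - (4 / 3 * q ^ 3) - (- (4 / 3 * p ^ 3) + 2 * a * p)).
    assert (Hr3 : one_plus_O (/ p) c3 (exp eta)).
    { apply one_plus_O_exp; [lra|]. unfold eta, H.
      apply (phase_expansion p q a d D); [easy | easy | unfold d; rewrite Eq2; unfold Z; ring | lra | easy]. }
    assert (Ee : e = exp (- (4 / 3 * p ^ 3) + 2 * a * p) * exp eta).
    { unfold e. rewrite <- exp_plus. f_equal. unfold eta. ring. }
    pose proof (exp_pos (- (4 / 3 * p ^ 3) + 2 * a * p)) as Hex.
    fold d.
    replace (d / (kappa * exp (- (4 / 3 * p ^ 3) + 2 * a * p)))
      with (r1 * (M z / M (- a)) * exp eta).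
    2:{ rewrite Ed, Hkap, Ee. field. repeat split; lra. }
    apply (one_plus_O_mult (/ p)); [lra | | exact Hr3].
    apply one_plus_O_mult; [lra | exact Hr1 | exact Hr2]. }
  destruct Hlarge as [K [HK HKp]].
  set (B := a / (kappa * exp (- (4 / 3 * p0 ^ 3))) + 1).
  assert (Hp0 : 0 < p0) by (unfold p0; lra).
  assert (HB : 0 < B).
  { unfold B. apply Rplus_lt_0_compat; [|lra]. apply Rdiv_lt_0_compat; [easy|].
    apply Rmult_lt_0_compat; [easy | apply exp_pos]. }
  exists (K + p0 * B). intros p X Hp HX HN.
  assert (Hip : 0 < / p) by now apply Rinv_0_lt_compat.
  destruct (Rle_dec p0 p) as [Hpp|Hpp].
  - specialize (HKp p X Hpp HX HN). assert (0 < p0 * B * / p) by (repeat apply Rmult_lt_0_compat; easy). lra.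
  - (* for bounded p the claim only says that the ratio is bounded *)
    apply Rle_trans with B.
    + assert (Hexp : exp (- (4 / 3 * p0 ^ 3)) <= exp (- (4 / 3 * p ^ 3) + 2 * a * p)).
      { apply exp_le_compat. assert (p ^ 3 <= p0 ^ 3) by (apply pow_incr; lra). nra. }
      pose proof (exp_pos (- (4 / 3 * p0 ^ 3))).
      set (ex := exp (- (4 / 3 * p ^ 3) + 2 * a * p)) in *.
      assert (0 <= (X + a) / (kappa * ex) <= a / (kappa * exp (- (4 / 3 * p0 ^ 3)))).
      { split.
        - apply Rdiv_le_0_compat; nra.
        - apply Rmult_le_compat; [lra | left; apply Rinv_0_lt_compat; nra | lra|].
          apply Rinv_le_contravar; nra. }
      unfold B. apply Rabs_le. lra.
    + apply Rle_trans with (p0 * / p * B).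
      * assert (1 <= p0 * / p) by (apply Rle_div_r; lra). nra.
      * nra.
Qed.

(** The relation behind all four is [hpar ^ 2 * c ^ 3 = 1]. *)
Lemma hpar_powers hbar m L0 V0 (h := hpar hbar m L0 V0) (p := sqrt (cpar hbar m L0 V0)) :
  0 < hbar -> 0 < m -> 0 < L0 -> 0 < V0 ->
  Rpower h (- 2 / 3) = p ^ 2 /\ Rpower h (- 1 / 3) = p /\ / h = p ^ 3 /\
  Rpower h (1 / 3) = / p.
Proof.
  intros Hh Hm HL HV.
  assert (Hc : 0 < cpar hbar m L0 V0) by (apply Rmult_lt_0_compat; [apply theta_pos | easy]).
  assert (Hp : 0 < p) by now apply sqrt_lt_R0.
  assert (Hp2 : p ^ 2 = cpar hbar m L0 V0).
  { unfold p. simpl. rewrite Rmult_1_r. apply sqrt_sqrt. lra. }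
  assert (H2 : 0 < 2 * m * V0) by (repeat apply Rmult_lt_0_compat; lra).
  assert (Hs : 0 < sqrt (2 * m * V0)) by now apply sqrt_lt_R0.
  assert (Hhp : 0 < h).
  { apply Rdiv_lt_0_compat; [easy|]. now apply Rmult_lt_0_compat. }
  assert (E2 : (h * p ^ 3) ^ 2 = 1).
  { replace ((h * p ^ 3) ^ 2) with (h ^ 2 * (p ^ 2) ^ 3) by ring. rewrite Hp2.
    unfold cpar. rewrite Rpow_mult_distr, theta_cube by easy. unfold h, hpar.
    replace ((hbar / (L0 * sqrt (2 * m * V0))) ^ 2)
      with (hbar ^ 2 / (L0 ^ 2 * (sqrt (2 * m * V0) * sqrt (2 * m * V0)))) by (field; lra).
    rewrite sqrt_sqrt by lra. field. lra. }
  assert (Hp3 : 0 < p ^ 3) by now apply pow_lt.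
  assert (E1 : h * p ^ 3 = 1) by (assert (0 < h * p ^ 3) by nra; nra).
  assert (Eh : h = Rpower p (- (3))).
  { rewrite Rpower_Ropp. replace 3 with (INR 3) by (simpl; ring).
    rewrite Rpower_pow by easy. apply (Rmult_eq_reg_r (p ^ 3)); [|lra].
    rewrite E1. field. lra. }
  rewrite Eh, !Rpower_mult. repeat split.
  - replace (- (3) * (-2 / 3)) with (INR 2) by (simpl; field). now apply Rpower_pow.
  - replace (- (3) * (-1 / 3)) with 1 by field. now apply Rpower_1.
  - rewrite Rpower_Ropp, Rinv_inv. replace 3 with (INR 3) by (simpl; ring).
    now apply Rpower_pow.
  - replace (- (3) * (1 / 3)) with (- (1)) by field. rewrite Rpower_Ropp. f_equal. now apply Rpower_1.
Qed.

Lemma airy_solution_airy y y0 y1 : airy_solution y y0 y1 -> airy y (Derive y).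
Proof.
  intros [H1 [H2 _]] x. split; [apply Derive_correct, H1 | apply H2].
Qed.

Lemma Ai_pair u Ai (k := 3 * full_moment 3 1) : airy_solution u 1 0 -> is_Ai Ai ->
  airy_pair u (Derive u) (fun x => k * Ai x) (fun x => k * Derive Ai x) /\
  - Ai 0 / Derive Ai 0 = / airy_slope /\ 0 < k.
Proof.
  intros Hu HA. destruct full_moment_pos as [G0 G1].
  pose proof (airy_solution_airy _ _ _ Hu) as Fu. pose proof (airy_solution_airy _ _ _ HA) as FA.
  destruct Hu as [_ [_ [U0 U1]]]. destruct HA as [_ [_ [A0 A1]]].
  destruct Ai_initial_values as [V0 V1]. rewrite V0 in A0. rewrite V1 in A1.
  split; [split|split]; auto.
  - now apply airy_scal.
  - rewrite A0. unfold k. field. lra.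
  - rewrite A1. unfold k, airy_slope. field. lra.
  - rewrite A0, A1. unfold airy_slope. field. lra.
  - unfold k. lra.
Qed.

Theorem theorem2 :
  forall (u Ai : R -> R) (a1 : R),
  airy_solution u 1 0 ->
  is_Ai Ai ->
  is_largest_zero (Derive Ai) (- a1) ->
  let alpha := - Ai 0 / Derive Ai 0 in
  (forall hbar m L0 V0 E : R,
     0 < hbar -> 0 < m -> 0 < L0 -> 0 < V0 ->
     is_Emin0 hbar m L0 V0 E ->
     let c := cpar hbar m L0 V0 in
     let bE := theta hbar m L0 V0 * E in
     - c < bE < Rmin (- c / 2) (- c + a1))
  /\
  (forall tau : R, 0 < tau ->
   exists K : R,
   forall hbar m L0 V0 E : R,
     0 < hbar -> 0 < m -> 0 < L0 -> 0 < V0 ->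
     is_Emin0 hbar m L0 V0 E ->
     let h := hpar hbar m L0 V0 in
     let bE := theta hbar m L0 V0 * E in
     h <= Rpower (a1 + tau) (- 3 / 2) ->
     exists r : R,
       Rabs r <= K * Rpower h (1 / 3) /\
       bE = - Rpower h (- 2 / 3) + a1
            - alpha * sqrt 3 * ((Derive u (- a1)) ^ 2 / a1)
              * exp (- (4 / 3) * / h + 2 * a1 * Rpower h (- 1 / 3))
              * (1 + r)).
Proof.
  intros u Ai a1 Hu HA Hz alpha.
  destruct (Ai_pair u Ai Hu HA) as [HP [Halpha Hk]].
  set (k := 3 * full_moment 3 1) in *.
  assert (Hz' : is_largest_zero (fun x => k * Derive Ai x) (- a1)).
  { destruct Hz as [Z0 Z1]. split; [rewrite Z0; ring|].
    intros x Hx. apply Z1. apply Rmult_integral in Hx. destruct Hx; [lra | easy]. }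
  pose proof airy_slope_pos as HW.
  pose proof (largest_zero_pos _ _ _ _ a1 HP Hz') as Ha.
  pose proof (pair_u'_pos_left _ _ _ _ a1 (- a1) HP Hz' ltac:(lra)) as Hua.
  split.
  - intros hbar m L0 V0 E Hh Hm HL HV HE c bE.
    destruct (ground_state_location _ _ _ _ a1 hbar m L0 V0 E HP Hz' Hh Hm HL HV HE)
      as [H1 [H2 [H3 _]]].
    fold c bE in H1, H2, H3. split; [lra|]. apply Rmin_glb_lt; lra.
  - intros tau _.
    destruct (splitting_asymptotics _ _ _ _ a1 HP Hz') as [K HK].
    exists K. intros hbar m L0 V0 E Hh Hm HL HV HE h bE _.
    destruct (ground_state_location _ _ _ _ a1 hbar m L0 V0 E HP Hz' Hh Hm HL HV HE)
      as [H1 [_ [H3 H4]]].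
    destruct (hpar_powers hbar m L0 V0 Hh Hm HL HV) as [P1 [P2 [P3 P4]]].
    fold h in P1, P2, P3, P4. rewrite P1, P2, P3, P4.
    assert (Hc : 0 < cpar hbar m L0 V0) by (apply Rmult_lt_0_compat; [apply theta_pos | easy]).
    set (p := sqrt (cpar hbar m L0 V0)) in *.
    assert (Hp : 0 < p) by now apply sqrt_lt_R0.
    assert (Hp2 : p ^ 2 = cpar hbar m L0 V0).
    { unfold p. simpl. rewrite Rmult_1_r. apply sqrt_sqrt. lra. }
    rewrite <- Hp2 in H1, H3, H4. fold bE in H1, H3, H4.
    specialize (HK p (- p ^ 2 - bE) Hp ltac:(lra) H4).
    replace (- (4 / 3) * p ^ 3 + 2 * a1 * p) with (- (4 / 3 * p ^ 3) + 2 * a1 * p) by ring.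
    set (ex := exp (- (4 / 3 * p ^ 3) + 2 * a1 * p)) in *.
    assert (Hex : 0 < ex) by apply exp_pos.
    destruct sqrt3_spec as [_ S3].
    eexists. split; [exact HK|].
    unfold alpha. rewrite Halpha. field. repeat split; lra.
Qed.
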